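(* Let $1\le k<n$ be integers. The expected number $f(0,k,n)$ of vertices of a random $k$-dimensional central section of the $n$-cube $[-1,1]^n$ is given by $$f(0,k,n)=2^k\binom{n}{k}\sqrt{\frac{2k}{\pi}}\int_0^{\infty}e^{-kt^2/2}\,\gamma_{n-k}\big(tB_\infty^{n-k}\big)\,dt.$$
   Context: $B_\infty^m=[-1,1]^m\subset\mathbb{R}^m$, and $tB_\infty^m=[-t,t]^m$ for $t\ge 0$. $\gamma_m$ is the standard Gaussian probability measure on $\mathbb{R}^m$ with density $(2\pi)^{-m/2}\exp(-\sum_{i=1}^m x_i^2/2)$. $G_{n,k}$ is the set of $k$-dimensional linear subspaces of $\mathbb{R}^n$ with its normalized rotation-invariant probability measure (the image of normalized Haar measure on the orthogonal group $O(n)$ under $g\mapsto g(\mathrm{span}(e_1,\dots,e_k))$, where $e_1,\dots,e_n$ is the standard basis). For integers $0\le j<k<n$, $f(j,k,n)$ denotes the expected number of $j$-dimensional faces of the polytope $X\cap[-1,1]^n$, where $X$ is random in $G_{n,k}$ according to this measure. *)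

(* Defs.v *)
From HB Require Import structures.
From mathcomp Require Import all_boot all_order all_algebra.
From mathcomp Require Import all_classical all_reals all_analysis.

Set Implicit Arguments.
Unset Strict Implicit.
Unset Printing Implicit Defensive.

Import Order.TTheory GRing.Theory Num.Theory.
Import numFieldNormedType.Exports.

Local Open Scope classical_set_scope.
Local Open Scope ring_scope.

Section orthogonal.
Context (R : realType) (n : nat).

Definition orthogonal_set : set 'M[R]_n := [set g | g *m g^T = 1%:M].

Definition orthogonal_group : Type := set_type orthogonal_set.

HB.instance Definition _ := Topological.copy orthogonal_group
  (set_type orthogonal_set).

Definition orthogonal_mx (g : orthogonal_group) : 'M[R]_n := set_val g.

Lemma orthogonal_mxP (g : orthogonal_group) :
  orthogonal_mx g *m (orthogonal_mx g)^T = 1%:M.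
Proof. exact: set_valP g. Qed.

Lemma orthogonal_set1 : orthogonal_set 1%:M.
Proof. by rewrite /orthogonal_set /= mul1mx trmx1. Qed.

HB.instance Definition _ :=
  isPointed.Build orthogonal_group (SigSub (mem_set orthogonal_set1)).

(* Borel sigma-algebra of the topology induced by the space of matrices *)
HB.instance Definition _ :=
  @isMeasurable.Build (sigma_display (@open orthogonal_group)) orthogonal_group
    <<s @open orthogonal_group >> (@sigma_algebra0 _ setT _)
    (@sigma_algebraC _ _) (@sigma_algebra_bigcup _ setT _).

Lemma orthogonal_set_mul (g h : orthogonal_group) :
  orthogonal_set (orthogonal_mx g *m orthogonal_mx h).
Proof.
rewrite /orthogonal_set /= trmx_mul mulmxA -(mulmxA (orthogonal_mx g)).
by rewrite orthogonal_mxP mulmx1 orthogonal_mxP.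
Qed.

Definition orthogonal_mul (g h : orthogonal_group) : orthogonal_group :=
  SigSub (mem_set (orthogonal_set_mul g h)).

(* Left invariance only; normalization comes from mu being a probability. *)
Definition is_haar (mu : probability orthogonal_group R) : Prop :=
  forall (g : orthogonal_group) (A : set orthogonal_group), measurable A ->
    mu (orthogonal_mul g @^-1` A) = mu A.

End orthogonal.

Section grassmannian.
Context (R : realType) (n k : nat) (le_kn : (k <= n)%N).

Definition coord_vectors : k.-tuple 'cV[R]_n :=
  [tuple delta_mx (widen_ord le_kn i) 0 | i < k].

Definition coord_subspace : {vspace 'cV[R]_n} := <<coord_vectors>>%VS.

Definition rotated_subspace (g : orthogonal_group R n) : {vspace 'cV[R]_n} :=
  (linfun (mulmx (orthogonal_mx g)) @: coord_subspace)%VS.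

Lemma dim_coord_subspace : \dim coord_subspace = k.
Proof.
suff /eqP -> : free coord_vectors by rewrite size_tuple.
apply/freeP => c /matrixP c0 i; have := c0 (widen_ord le_kn i) 0.
have cE (j : 'I_k) : (c j *: coord_vectors`_j) (widen_ord le_kn i) 0 =
    c j * (i == j)%:R.
  by rewrite -tnth_nth tnth_mktuple !mxE eqxx andbT -val_eqE.
rewrite summxE mxE (bigD1 i) //= cE eqxx mulr1 big1 ?addr0 // => j ji.
by rewrite cE eq_sym (negPf ji) mulr0.
Qed.

Lemma dim_rotated_subspace (g : orthogonal_group R n) :
  \dim (rotated_subspace g) = k.
Proof.
rewrite limg_dim_eq ?dim_coord_subspace //.
suff /eqP -> : lker (linfun (mulmx (orthogonal_mx g)) :
  'Hom('cV[R]_n, 'cV[R]_n)) == 0%VS by rewrite capv0.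
apply/lker0P => x y; rewrite !lfunE /= => gxy.
have /mulmx1C gVg := orthogonal_mxP g.
by rewrite -[x]mul1mx -[y]mul1mx -gVg -!mulmxA gxy.
Qed.

(* The bound k <= n is a parameter because types must be inhabited to carry a
   measurable structure. *)
Definition grassmannian & (k <= n)%N : Type :=
  set_type [set V : {vspace 'cV[R]_n} | \dim V = k].

Definition orbit_map (g : orthogonal_group R n) : grassmannian le_kn :=
  SigSub (mem_set (dim_rotated_subspace g)).

HB.instance Definition _ := Choice.copy (grassmannian le_kn)
  (set_type [set V : {vspace 'cV[R]_n} | \dim V = k]).
HB.instance Definition _ :=
  isPointed.Build (grassmannian le_kn) (orbit_map point).

(* The final sigma-algebra of the orbit map: it is the largest one on which the
   image measure is defined, and it contains the Borel sets of the quotient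
   topology. *)
Definition grassmannian_measurable : set (set (grassmannian le_kn)) :=
  image_set_system setT orbit_map measurable.

Let sigma_algebra_grassmannian : sigma_algebra setT grassmannian_measurable.
Proof. exact/sigma_algebra_image/sigma_algebra_measurable. Qed.

Let gr0 : grassmannian_measurable set0.
Proof. by case: sigma_algebra_grassmannian. Qed.

Let grC A : grassmannian_measurable A -> grassmannian_measurable (~` A).
Proof.
by case: sigma_algebra_grassmannian => _ + _ => /[apply]; rewrite setTD.
Qed.

Let gr_bigcup (F : (set (grassmannian le_kn))^nat) :
  (forall i, grassmannian_measurable (F i)) ->
  grassmannian_measurable (\bigcup_i F i).
Proof. by case: sigma_algebra_grassmannian => _ _; exact. Qed.

HB.instance Definition _ :=
  @isMeasurable.Build (sigma_display grassmannian_measurable)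
    (grassmannian le_kn) grassmannian_measurable gr0 grC gr_bigcup.

Lemma measurable_orbit_map : measurable_fun setT orbit_map.
Proof. by move=> _ A; rewrite /measurable. Qed.

HB.instance Definition _ :=
  isMeasurableFun.Build _ _ _ _ orbit_map measurable_orbit_map.

Definition grassmannian_measure (mu : probability (orthogonal_group R n) R) :
    probability (grassmannian le_kn) R :=
  distribution mu orbit_map.

End grassmannian.

Section polytopes.
Context (R : realType) (n : nat).
Implicit Types (P F : set 'cV[R]_n) (V W : {vspace 'cV[R]_n}).

Definition dot (c x : 'cV[R]_n) : R := \sum_i c i 0 * x i 0.

(* The empty face and P itself (c = 0) are allowed, as usual. *)
Definition is_face P F : Prop :=
  exists (c : 'cV[R]_n) (b : R),
    (forall x, P x -> dot c x <= b) /\ F = P `&` [set x | dot c x = b].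

(* The affine hull of F is x + V, with V spanned by the differences y - x. *)
Definition affine_dim F (j : nat) : Prop :=
  exists2 x, F x & exists V, [/\ \dim V = j,
    forall y, F y -> y - x \in V &
    forall W, (forall y, F y -> y - x \in W) -> (V <= W)%VS].

Definition num_faces (j : nat) P : \bar R :=
  counting [set F | is_face P F /\ affine_dim F j].

Definition cube : set 'cV[R]_n := [set x | forall i, `|x i 0| <= 1].

End polytopes.

(* mu is meant to be the Haar probability measure on O(n), so that the integral
   is the expectation of the number of faces of a uniform random section. *)
Definition expected_faces (R : realType) (n k : nat) (le_kn : (k <= n)%N)
    (mu : probability (orthogonal_group R n) R) (j : nat) : \bar R :=
  (\int[grassmannian_measure le_kn mu]_(X in [set: grassmannian R le_kn])
    num_faces j ([set x | x \in set_val X] `&` @cube R n))%E.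

Section tuple_product.
Context d (T : measurableType d) (R : realType) (m : nat).
Variables (mu : {sigma_finite_measure set T -> \bar R})
  (nu : {sigma_finite_measure set (m.-tuple T) -> \bar R}).

Definition tuple_cons (x : T * m.-tuple T) : m.+1.-tuple T :=
  [tuple of x.1 :: x.2].

Lemma measurable_tuple_cons : measurable_fun setT tuple_cons.
Proof. exact: (measurable_cons measurable_fst measurable_snd). Qed.

Definition tuple_uncons (t : m.+1.-tuple T) : T * m.-tuple T :=
  (tnth t ord0, [tuple of behead t]).

Lemma measurable_tuple_uncons : measurable_fun setT tuple_uncons.
Proof.
by apply: measurable_fun_pair; [exact: measurable_tnth|exact: measurable_behead].
Qed.

Lemma tuple_consK : cancel tuple_cons tuple_uncons.
Proof. by case=> x t; congr pair; apply: val_inj. Qed.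

Definition tuple_prod : set (m.+1.-tuple T) -> \bar R :=
  pushforward (mu \x nu)%E tuple_cons.

Let tuple_prod0 : tuple_prod set0 = 0%E.
Proof. by rewrite /tuple_prod /pushforward preimage_set0 measure0. Qed.

Let tuple_prod_ge0 A : (0 <= tuple_prod A)%E.
Proof. by rewrite /tuple_prod /pushforward; apply: measure_ge0. Qed.

Let tuple_prod_sigma_additive : semi_sigma_additive tuple_prod.
Proof.
move=> F mF tF mUF; rewrite /tuple_prod /pushforward preimage_bigcup.
have mcons A : measurable A -> measurable (tuple_cons @^-1` A).
  by move=> mA; rewrite -[X in measurable X]setTI; exact: measurable_tuple_cons.
apply: measure_semi_sigma_additive => [i||]; first exact: mcons.
- apply/trivIsetP => i j _ _ ij; rewrite -preimage_setI.
  by move/trivIsetP : tF => /(_ _ _ _ _ ij) ->//; rewrite preimage_set0.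
- by rewrite -preimage_bigcup; exact: mcons.
Qed.

HB.instance Definition _ := isMeasure.Build _ _ _ tuple_prod
  tuple_prod0 tuple_prod_ge0 tuple_prod_sigma_additive.

Let tuple_prod_sigma_finite : sigma_finite setT tuple_prod.
Proof.
have /sigma_finiteP[F [FT ndF Foo]] := sigma_finiteT mu.
have /sigma_finiteP[G [GT ndG Goo]] := sigma_finiteT nu.
exists (fun i => tuple_uncons @^-1` (F i `*` G i)).
  rewrite -preimage_bigcup -(preimage_setT tuple_uncons); congr preimage.
  rewrite -setXTT FT GT predeqE => -[x y]; split.
    move=> [/= [i _ Fix] [j _ Gjy]]; exists (maxn i j) => //; split.
    - by move: x Fix; exact/subsetPset/ndF/leq_maxl.
    - by move: y Gjy; exact/subsetPset/ndG/leq_maxr.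
  by move=> [i _ []/= ? ?]; split; exists i.
move=> i; have [mF ltF] := Foo i; have [mG ltG] := Goo i.
have mFG : measurable (F i `*` G i) by exact: measurableX.
split.
  by rewrite -[X in measurable X]setTI; exact: measurable_tuple_uncons.
rewrite /tuple_prod /pushforward -comp_preimage.
rewrite (_ : tuple_uncons \o tuple_cons = id); last first.
  by apply/funext => x; exact: tuple_consK.
by rewrite preimage_id product_measure1E// lte_mul_pinfty// ge0_fin_numE.
Qed.

HB.instance Definition _ := Measure_isSigmaFinite.Build _ _ _ tuple_prod
  tuple_prod_sigma_finite.

End tuple_product.

Section gaussian.
Context (R : realType).

(* Lebesgue measure on R^m, as the m-fold product of the measure on R *)
Fixpoint lebesgue_tuple (m : nat) :
    {sigma_finite_measure set (m.-tuple (measurableTypeR R)) -> \bar R} :=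
  match m with
  | 0 => dirac [tuple]
  | m'.+1 => tuple_prod lebesgue_measure (lebesgue_tuple m')
  end.

(* Here vectors are tuples, not columns, because the library equips tuples
   with the product sigma-algebra. *)
Definition gaussian_density (m : nat) (x : m.-tuple R) : R :=
  (2 * pi) `^ (- m%:R / 2) * expR (- (\sum_(i < m) tnth x i ^+ 2) / 2).

Definition gaussian (m : nat) (A : set (m.-tuple (measurableTypeR R))) :
    \bar R :=
  (\int[lebesgue_tuple m]_(x in A) (gaussian_density x)%:E)%E.

Definition cube_tuple (m : nat) (t : R) :
    set (m.-tuple (measurableTypeR R)) :=
  [set x | forall i, `|tnth x i| <= t].

End gaussian.

Arguments cube_tuple {R} m%_N t.

(* Main.v *)
From HB Require Import structures.
Require Import Defs.
From mathcomp Require Import all_boot all_order all_algebra.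
From mathcomp Require Import all_classical all_reals all_analysis.
From mathcomp Require Import perm measurable_realfun.
From mathcomp Require finmap.
From mathcomp Require Import ring lra zify.

(** Let X be the span of the first k columns of a Haar random orthogonal matrix g.

    Almost surely the section of the cube by X is in general position: for every set S
    of k coordinates, X projects bijectively onto the coordinates in S, and a point of X
    whose coordinates in S are all 1 or -1 has no other coordinate equal to 1 or -1.
    Then a vertex of the section has exactly k active coordinates, and the vertices
    correspond to the choices of S and of signs on S such that the point of X with these
    signs on S lies in the cube (num_vertices_generic). There are 2^k C(n, k) choices,
    so that it is enough to find the probability of one of them.

    Fix S and the signs eps, and let L be the space, of dimension n - k + 1, of the
    vectors that are proportional to eps on S. Almost surely X meets L along a line.
    Haar measure is invariant under the reflections along the vectors of L, so that all
    directions in L are alike for this line (isotropic_section_coord). The choice (S,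
    eps) gives a vertex when the line is in the cone of L where the coordinates outside
    S are bounded by the common absolute value of the coordinates in S. A standard
    Gaussian vector of L also has a uniform direction, and two uniform directions have
    the same law (isotropic_le), so that the probability is the Gaussian measure of this
    cone (section_cone_prob). Integrating first over the coordinate along eps / sqrt k,
    whose value at a vector is sqrt k times the common absolute value t of the
    coordinates in S up to sign, gives the measures of the cubes of half-side t
    (gauss_cone).

    General position is proved by the same invariance. A minor of g, reflected in the
    plane of two basis vectors, is a combination of two minors, and infinitely many
    reflections produce disjoint events of equal probability (minor_exchange_null). So
    the vanishing of one minor entails that of all the others, which is impossible for
    an invertible matrix (minor_null). The points with an extra active coordinate
    correspond to the boundary of the cone, which is Gaussian null.

    The rotation invariance of the Gaussian measure is used as a statement on the joint
    law of a linear form and the norm, proved by induction on the dimension from the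
    planar case (ge0_integral_gauss_dot). *)

Import Order.TTheory GRing.Theory Num.Theory.
Import numFieldNormedType.Exports.

Set Implicit Arguments.
Unset Strict Implicit.
Unset Printing Implicit Defensive.

Local Open Scope classical_set_scope.
Local Open Scope ring_scope.

(** * Affine substitutions and densities *)

Section affine.
Context {R : realType}.
Local Notation leb := (@lebesgue_measure R).
Local Open Scope ereal_scope.

Definition affine (a b : R) (x : measurableTypeR R) : measurableTypeR R :=
  (a * x + b)%R.

Lemma measurable_affine a b : measurable_fun setT (affine a b).
Proof. by apply: measurable_funD => //; exact: measurable_funM. Qed.

Lemma affine_preimage_itv (a b : R) u v : (0 < a)%R ->
  affine a b @^-1` `]u, v] = `]((u - b) / a)%R, ((v - b) / a)%R]%classic.
Proof.
move=> a0; apply/seteqP; split => x /=; rewrite !in_itv /= /affine.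
- move=> /andP[ux xv]; rewrite ltr_pdivrMr// ler_pdivlMr//; lra.
- rewrite ltr_pdivrMr// ler_pdivlMr// => /andP[ux xv]; lra.
Qed.

Lemma lebesgue_measure_affine_gt0 (a b : R) (A : set (measurableTypeR R)) : (0 < a)%R ->
  measurable A -> leb A = a%:E * leb (affine a b @^-1` A).
Proof.
move=> a0 mA.
have an : (0 <= a)%R by exact: ltW.
pose nu : {measure set (measurableTypeR R) -> \bar R} :=
  mscale (NngNum an) (pushforward leb (affine a b)).
have -> : leb A = nu (measurable_affine a b) A; last by [].
apply: lebesgue_measure_unique mA => _ [[u v]] _ <-.
rewrite /nu /= /mscale /= /pushforward affine_preimage_itv// !lebesgue_measure_itv/=.
rewrite !lte_fin ltr_pM2r ?invr_gt0// ltrD2r; case: ifPn => _; last by rewrite mule0.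
by rewrite -!EFinM; congr EFin; field; rewrite gt_eqF.
Qed.

Lemma lebesgue_measure_affine (a b : R) (A : set (measurableTypeR R)) :
  a != 0%R -> measurable A -> leb A = `|a|%:E * leb (affine a b @^-1` A).
Proof.
move=> a0 mA; have [a_gt0|a_le0] := ltP 0%R a.
  by rewrite gtr0_norm//; exact: (@lebesgue_measure_affine_gt0 a b A).
have a_lt0 : (a < 0)%R by rewrite lt_neqAle a0.
rewrite ltr0_norm// (@lebesgue_measure_affine_gt0 (- a)%R b)// ?oppr_gt0//.
congr (_ * _); rewrite -lebesgue_measureN.
  rewrite /pushforward -comp_preimage (_ : _ \o _ = affine a b)//.
  by apply/funext => x /=; rewrite /affine; lra.
by rewrite -[X in measurable X]setTI; exact: (@measurable_affine (- a)%R b).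
Qed.

(** Lebesgue measure is determined by its values on the half-open intervals, so that
    this change of variables needs no regularity of f. *)
Lemma ge0_integral_affine (a b : R) (f : measurableTypeR R -> \bar R) : a != 0%R ->
  measurable_fun setT f -> (forall x, 0 <= f x) ->
  \int[leb]_x f x = `|a|%:E * \int[leb]_x f (affine a b x).
Proof.
move=> a0 mf f0.
have mff := measurableT_comp mf (measurable_affine a b).
pose nu : {measure set (measurableTypeR R) -> \bar R} :=
  mscale (NngNum (normr_ge0 a)) (pushforward leb (affine a b)).
transitivity (\int[nu (measurable_affine a b)]_x f x).
  by apply: eq_measure_integral => A mA _; exact: lebesgue_measure_affine.
rewrite /nu ge0_integral_mscale// ge0_integral_pushforward//.
exact: (measurable_affine a b).
Qed.
End affine.

Section density.
Local Open Scope ereal_scope.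
Context d (T : measurableType d) (R : realType).
Variables (mu nu : {measure set T -> \bar R}) (g : T -> R).
Hypothesis g0 : forall x, (0 <= g x)%R.
Hypothesis mg : measurable_fun setT g.
Hypothesis nuE : forall A, measurable A -> nu A = \int[mu]_(x in A) (g x)%:E.

Import HBNNSimple.

Let density_nnsfun (h : {nnsfun T >-> R}) :
  \int[nu]_x (h x)%:E = \int[mu]_x ((h x)%:E * (g x)%:E).
Proof.
under [LHS]eq_integral do rewrite fimfunE -fsumEFin//.
rewrite [LHS]ge0_integral_fsum//; last 2 first.
  - by move=> r; exact/measurable_EFinP/measurableT_comp.
  - by move=> n x _; exact: nnfun_muleindic_ge0.
transitivity (\int[mu]_x (\sum_(y \in range h)
    (y * \1_(h @^-1` [set y]) x)%:E * (g x)%:E)).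
  rewrite ge0_integral_fsum//; last 2 first.
  - by move=> y; apply: emeasurable_funM => //; exact/measurable_EFinP/measurableT_comp.
  - by move=> m y Ey; apply: mule_ge0; [exact: nnfun_muleindic_ge0|rewrite lee_fin].
  apply: eq_fsbigr => r rh; rewrite integralZl_indic_nnsfun//.
  under [RHS]eq_integral do rewrite EFinM -muleA.
  rewrite ge0_integralZl//.
  - rewrite integral_indic// setIT nuE// integral_mkcond; congr (_ * _).
    apply: eq_integral => x _; rewrite patchE indicE; case: ifPn => _.
      by rewrite mul1e.
    by rewrite mul0e.
  - by apply: emeasurable_funM => //; exact/measurable_EFinP.
  - by move=> t _; rewrite mule_ge0 ?lee_fin.
  - by move: rh; rewrite inE => -[t _ <-]; rewrite lee_fin.
apply: eq_integral => x _; rewrite -ge0_mule_fsuml => [|y]; last first.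
  exact: nnfun_muleindic_ge0.
by rewrite fsumEFin // -(fimfunE _ x).
Qed.

(** Both sides are limits along the same simple functions, for which the claim is the
    hypothesis on the density. *)
Lemma ge0_integral_density (f : T -> \bar R) : measurable_fun setT f ->
  (forall x, 0 <= f x) -> \int[nu]_x f x = \int[mu]_x (f x * (g x)%:E).
Proof.
move=> mf f0; pose h := nnsfun_approx measurableT mf.
have hf x : (h n x)%:E @[n --> \oo] --> f x by exact: cvg_nnsfun_approx.
transitivity (limn (fun n => \int[nu]_x (h n x)%:E)).
  rewrite -monotone_convergence//.
  - by apply: eq_integral => x _; apply/esym/cvg_lim => //; exact: hf.
  - by move=> n; exact/measurable_EFinP.
  - by move=> n x _; rewrite lee_fin.
  - by move=> x _ a b ab; rewrite lee_fin; exact/lefP/nd_nnsfun_approx.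
under eq_fun do rewrite density_nnsfun.
rewrite -monotone_convergence//.
- apply: eq_integral => x _; apply/cvg_lim => //.
  by apply: cvgeZr => //; exact: hf.
- by move=> n; apply: emeasurable_funM => //; exact/measurable_EFinP.
- by move=> n x _; rewrite mule_ge0 ?lee_fin.
- move=> x _ a b ab; rewrite lee_wpmul2r ?lee_fin//.
  exact/lefP/nd_nnsfun_approx.
Qed.

End density.

(** * Gaussian measure and rotations *)

Section rotation.
Context {R : realType}.
Local Notation T := (measurableTypeR R).
Local Notation leb := (@lebesgue_measure R).
Local Open Scope ereal_scope.

Lemma measurable_lincomb (a b : R) :
  measurable_fun setT (fun p : T * T => (a * p.1 + b * p.2)%R : T).
Proof. by apply: measurable_funD; apply: measurable_funM. Qed.

(** Fubini reduces the rotation to two affine substitutions on the line: with x fixed, y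
    is replaced by u = c x + s y; with u fixed, x is then replaced by the second rotated
    coordinate, which equals (c u - x) / s. The two Jacobians s and 1 / s cancel. *)
Lemma ge0_integral_lebesgue_rotation (c s : R) (G : T * T -> \bar R) :
  (c ^+ 2 + s ^+ 2 = 1)%R -> measurable_fun setT G -> (forall p, 0 <= G p) ->
  \int[leb]_x \int[leb]_y G (c * x + s * y, c * y - s * x)%R =
  \int[leb]_x \int[leb]_y G (x, y).
Proof.
move=> cs1 mG G0.
have mG1 u : measurable_fun setT (fun v : T => G (u, v)).
  exact: measurableT_comp.
have mG2 v : measurable_fun setT (fun u : T => G (u, v)).
  exact: measurableT_comp.
have [s0|s0] := eqVneq s 0%R.
  have c1 : (`|c| = 1)%R.
    move: cs1; rewrite s0 expr0n /= addr0 => /eqP; rewrite sqrf_eq1.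
    by move=> /orP[] /eqP ->; rewrite ?normrN normr1.
  have c0 : c != 0%R by rewrite -normr_eq0 c1 oner_neq0.
  rewrite [RHS](@ge0_integral_affine _ c 0%R)//; last 2 first.
  - exact: measurable_fun_fubini_tonelli_F.
  - by move=> x; exact: integral_ge0.
  rewrite c1 mul1e; apply: eq_integral => x _.
  rewrite [RHS](@ge0_integral_affine _ c 0%R)// c1 mul1e.
  apply: eq_integral => y _; rewrite /affine s0.
  by congr (G (_, _)); lra.
pose H (p : T * T) := G (p.2, (c * p.2 - p.1) / s)%R.
have mH : measurable_fun setT H.
  apply: measurableT_comp mG _; apply: measurable_fun_pair => //.
  rewrite [X in measurable_fun _ X](_ : _ =
    (fun p : T * T => (- s^-1 * p.1 + c / s * p.2)%R)); last first.
    by apply/funext => p; ring.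
  exact: measurable_lincomb.
have H0 p : 0 <= H p by exact: G0.
have mH1 x : measurable_fun setT (fun u : T => H (x, u)).
  exact: measurableT_comp.
have s1 : (`|s| * `|- s^-1| = 1)%R.
  by rewrite normrN normfV divff// normr_eq0.
transitivity (`|- s^-1|%:E * \int[leb]_x \int[leb]_u H (x, u)).
  rewrite -ge0_integralZl//; last 2 first.
  - exact: (measurable_fun_fubini_tonelli_F _ mH H0).
  - by move=> x _; exact: integral_ge0.
  apply: eq_integral => x _.
  rewrite (@ge0_integral_affine _ s (c * x)%R (fun u => H (x, u)))//.
  rewrite muleA -EFinM [(`|- s^-1| * _)%R]mulrC s1 mul1e; apply: eq_integral => y _.
  rewrite /H /affine /= (addrC (s * y)%R); congr (G (_, _)).
  rewrite (addrC (c * x)%R).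
  have -> : (c * (s * y + c * x) - x = s * (c * y - s * x))%R.
    by rewrite (_ : c * (s * y + c * x) - x = s * c * y - (1 - c ^+ 2) * x)%R;
      [rewrite -cs1; ring|ring].
  by rewrite mulrAC mulfV// mul1r.
rewrite fubini_tonelli// -ge0_integralZl//; last 2 first.
- exact: (measurable_fun_fubini_tonelli_G _ mH H0).
- by move=> x _; exact: integral_ge0.
apply: eq_integral => u _.
rewrite [RHS](@ge0_integral_affine _ (- s^-1)%R (c * u / s)%R)//; last first.
  by rewrite oppr_eq0 invr_eq0.
congr (_ * _); apply: eq_integral => x _; rewrite /H /affine /=.
by congr (G (_, _)); lra.
Qed.

Local Notation normal := (@normal_prob R 0 1).

Lemma ge0_integral_normal (f : T -> \bar R) : measurable_fun setT f ->
  (forall x, 0 <= f x) ->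
  \int[normal]_x f x = \int[leb]_x (f x * (normal_pdf 0 1 x)%:E).
Proof.
move=> mf f0; apply: ge0_integral_density => //; first exact: normal_pdf_ge0.
exact: measurable_normal_pdf.
Qed.

Lemma normal_pdf01E x : normal_pdf 0 1 x = (normal_peak 1 * expR (- x ^+ 2 / 2))%R :> R.
Proof.
by rewrite normal_pdfE ?oner_neq0// /normal_fun subr0 expr1n.
Qed.

Lemma normal_pdf01M x y : (normal_pdf 0 1 x * normal_pdf 0 1 y)%R =
  (normal_peak 1 ^+ 2 * expR (- (x ^+ 2 + y ^+ 2) / 2))%R :> R.
Proof.
rewrite !normal_pdf01E opprD mulrDl expRD; ring.
Qed.

Lemma ge0_integral_normal2 (F : T * T -> \bar R) : measurable_fun setT F ->
  (forall p, 0 <= F p) ->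
  \int[normal]_x \int[normal]_y F (x, y) =
  \int[leb]_x \int[leb]_y (F (x, y) *
    (normal_peak 1 ^+ 2 * expR (- (x ^+ 2 + y ^+ 2) / 2))%:E).
Proof.
move=> mF F0.
have mp : measurable_fun setT (fun y : T => (normal_pdf 0 1 y)%:E).
  apply/measurable_EFinP; exact: (@measurable_normal_pdf R 0 1).
have mF1 u : measurable_fun setT (fun v : T => F (u, v)).
  exact: measurableT_comp.
rewrite ge0_integral_normal//; last 2 first.
- exact: measurable_fun_fubini_tonelli_F.
- by move=> x; exact: integral_ge0.
apply: eq_integral => x _; rewrite muleC ge0_integral_normal//.
rewrite -ge0_integralZl//.
- by apply: eq_integral => y _; rewrite muleCA -EFinM normal_pdf01M.
- exact: emeasurable_funM.
- by move=> y _; rewrite mule_ge0 ?lee_fin ?normal_pdf_ge0.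
- by rewrite lee_fin normal_pdf_ge0.
Qed.

(** The planar Gaussian measure is rotation invariant: the joint law of a linear form
    and of the squared norm only depends on the length of the form. *)
Lemma ge0_integral_normal_rotation (a b : R) (F : T * T -> \bar R) :
  measurable_fun setT F -> (forall p, 0 <= F p) ->
  \int[normal]_x \int[normal]_y F (a * x + b * y, x ^+ 2 + y ^+ 2)%R =
  \int[normal]_x \int[normal]_y
    F (Num.sqrt (a ^+ 2 + b ^+ 2) * x, x ^+ 2 + y ^+ 2)%R.
Proof.
move=> mF F0; set r := Num.sqrt _.
have mL (u v : R) : measurable_fun setT
    (fun p : T * T => F (u * p.1 + v * p.2, p.1 ^+ 2 + p.2 ^+ 2)%R).
  apply: measurableT_comp mF _; apply: measurable_fun_pair.
    exact: measurable_lincomb.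
  by apply: measurable_funD; apply: measurable_funX.
have ab0 : (0 <= a ^+ 2 + b ^+ 2)%R by rewrite addr_ge0// sqr_ge0.
have r2 : (r ^+ 2 = a ^+ 2 + b ^+ 2)%R by rewrite sqr_sqrtr.
have [r0|r0] := eqVneq r 0%R.
  have ab : (a ^+ 2 + b ^+ 2 = 0)%R by rewrite -r2 r0 expr0n.
  have [a2 b2] := (sqr_ge0 a, sqr_ge0 b).
  have /eqP : (a ^+ 2 = 0)%R by lra.
  have /eqP : (b ^+ 2 = 0)%R by lra.
  rewrite !sqrf_eq0 => /eqP -> /eqP ->.
  apply: eq_integral => x _; apply: eq_integral => y _.
  by rewrite r0 !mul0r addr0.
pose Fab (p : T * T) := F (a * p.1 + b * p.2, p.1 ^+ 2 + p.2 ^+ 2)%R.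
pose Fr (p : T * T) := F (r * p.1, p.1 ^+ 2 + p.2 ^+ 2)%R.
pose w (p : T * T) := (normal_peak 1 ^+ 2 * expR (- (p.1 ^+ 2 + p.2 ^+ 2) / 2))%:E
  : \bar R.
pose G (p : T * T) := Fr p * w p.
have mFr : measurable_fun setT Fr.
  have := mL r 0%R; congr (measurable_fun setT _); apply/funext => p.
  by rewrite mul0r addr0.
transitivity (\int[normal]_x \int[normal]_y Fab (x, y)); first by [].
transitivity (\int[normal]_x \int[normal]_y Fr (x, y)); last by [].
transitivity (\int[leb]_x \int[leb]_y (Fab (x, y) * w (x, y))).
  exact: (ge0_integral_normal2 (mL a b) (fun p => F0 _)).
transitivity (\int[leb]_x \int[leb]_y G (x, y)); last first.
  by apply/esym; exact: (ge0_integral_normal2 mFr (fun p => F0 _)).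
have cs1 : ((a / r) ^+ 2 + (b / r) ^+ 2 = 1)%R.
  by rewrite !expr_div_n -mulrDl -r2 divff// expf_neq0.
rewrite -(ge0_integral_lebesgue_rotation cs1 (G := G)); last 2 first.
- apply: emeasurable_funM; first exact: mFr.
  apply/measurable_EFinP; apply: measurable_funM => //.
  apply: measurableT_comp => //; apply: measurable_funM => //.
  apply: measurableT_comp => //.
  by apply: measurable_funD; apply: measurable_funX.
- move=> p; apply: mule_ge0; first exact: F0.
  by rewrite lee_fin mulr_ge0 ?expR_ge0 ?sqr_ge0.
apply: eq_integral => x _; apply: eq_integral => y _.
rewrite /G /Fr /Fab /w /=.
have -> : ((a / r * x + b / r * y) ^+ 2 + (a / r * y - b / r * x) ^+ 2 =
    x ^+ 2 + y ^+ 2)%R.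
  by rewrite -[RHS]mul1r -cs1; ring.
by rewrite (_ : r * _ = a * x + b * y)%R//; field.
Qed.

End rotation.

Section gauss.
Context {R : realType}.
Local Notation T := (measurableTypeR R).
Local Notation leb := (@lebesgue_measure R).
Local Notation normal := (@normal_prob R 0 1).
Local Open Scope ereal_scope.

Lemma ge0_integral_tuple_prod m
    (mu : {sigma_finite_measure set T -> \bar R})
    (nu : {sigma_finite_measure set (m.-tuple T) -> \bar R})
    (f : m.+1.-tuple T -> \bar R) : measurable_fun setT f -> (forall x, 0 <= f x) ->
  \int[tuple_prod mu nu]_y f y =
  \int[mu]_x \int[nu]_t f (tuple_cons (x, t)).
Proof.
move=> mf f0.
have mc := @measurable_tuple_cons _ T m.
transitivity (\int[pushforward (mu \x nu) (@tuple_cons _ T m)]_y f y); first by [].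
rewrite ge0_integral_pushforward// preimage_setT.
rewrite (fubini_tonelli1 (f \o @tuple_cons _ T m))//.
- exact: measurableT_comp.
- by move=> p; exact: f0.
Qed.

(** The iterated product of the normal law; the one-dimensional factors are kept apart
    from the Lebesgue measure so that Fubini applies coordinatewise. *)
Fixpoint gauss m : {sigma_finite_measure set (m.-tuple T) -> \bar R} :=
  match m with
  | 0 => dirac [tuple]
  | m'.+1 => tuple_prod normal (gauss m')
  end.

Lemma gauss_setT m : gauss m setT = 1.
Proof.
elim: m => [|m IH] /=; first by rewrite diracT.
rewrite /tuple_prod /pushforward preimage_setT -setXTT product_measure1E//.
by rewrite IH mule1; exact: probability_setT.
Qed.

Lemma measurable_gaussian_density m :
  measurable_fun setT (@gaussian_density R m : m.-tuple T -> R).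
Proof.
apply: measurable_funM => //; apply: measurableT_comp => //.
apply: measurable_funM => //; apply: measurableT_comp => //.
apply: measurable_sum => i; apply: measurable_funX; exact: measurable_tnth.
Qed.

Lemma gaussian_density_cons m (x : T) (t : m.-tuple T) :
  gaussian_density (tuple_cons (x, t)) =
  (normal_pdf 0 1 x * gaussian_density t)%R :> R.
Proof.
rewrite /gaussian_density big_ord_recl normal_pdf01E.
rewrite (_ : tnth (tuple_cons (x, t)) ord0 = x)//.
under eq_bigr do rewrite tnthS.
have pi2 : (0 < 2 * pi :> R)%R by rewrite mulr_gt0// pi_gt0.
set S := (\sum_(i < m) _)%R.
have -> : (expR (- (x ^+ 2 + S) / 2) = expR (- x ^+ 2 / 2) * expR (- S / 2))%R.
  by rewrite -expRD; congr expR; ring.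
rewrite (_ : - m.+1%:R / 2 = - (2^-1) + - m%:R / 2 :> R)%R; last first.
  by rewrite -natr1; lra.
rewrite powRD; last by apply/implyP => _; rewrite gt_eqF.
rewrite (_ : normal_peak 1 = (2 * pi) `^ (- 2^-1))%R; last first.
  by rewrite powRN powR12_sqrt ?ltW// /normal_peak expr1n mul1r mulr_natl.
ring.
Qed.

Lemma ge0_integral_gauss m (f : m.-tuple T -> \bar R) : measurable_fun setT f ->
  (forall x, 0 <= f x) ->
  \int[gauss m]_x f x = \int[@lebesgue_tuple R m]_x (f x * (gaussian_density x)%:E).
Proof.
elim: m f => [|m IH] f mf f0 /=.
  have mfd : measurable_fun setT (fun x => f x * (gaussian_density x)%:E).
    apply: emeasurable_funM => //; apply/measurable_EFinP.
    exact: measurable_gaussian_density.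
  rewrite !integral_dirac// !diracT !mul1e /gaussian_density big_ord0.
  by rewrite oppr0 !mul0r powRr0 expR0 mulr1 mule1.
have mfd : measurable_fun setT (fun x => f x * (gaussian_density x)%:E).
  apply: emeasurable_funM => //; apply/measurable_EFinP.
  exact: measurable_gaussian_density.
have d0 k (x : k.-tuple T) : (0 <= gaussian_density x)%R.
  by rewrite mulr_ge0// ?powR_ge0 ?expR_ge0.
have mfc : measurable_fun setT (f \o @tuple_cons _ T m).
  by apply: measurableT_comp => //; exact: measurable_tuple_cons.
have mfc1 x : measurable_fun setT (fun t => f (tuple_cons (x, t))).
  exact: (measurableT_comp mfc (pair1_measurable _)).
rewrite !ge0_integral_tuple_prod//; last first.
  by move=> x; rewrite mule_ge0// lee_fin.
rewrite ge0_integral_normal//; last 2 first.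
- exact: (measurable_fun_fubini_tonelli_F _ mfc (fun p => f0 _)).
- by move=> x; exact: integral_ge0.
apply: eq_integral => x _; rewrite muleC IH// -ge0_integralZl//.
- by apply: eq_integral => t _; rewrite muleCA -EFinM gaussian_density_cons.
- apply: emeasurable_funM => //; apply/measurable_EFinP.
  exact: measurable_gaussian_density.
- by move=> t _; rewrite mule_ge0 ?lee_fin.
- by rewrite lee_fin normal_pdf_ge0.
Qed.

Lemma gaussianE m (A : set (m.-tuple T)) : measurable A -> gaussian A = gauss m A.
Proof.
move=> mA; rewrite -[RHS]mul1e -integral_cst// /gaussian !(integral_mkcond A).
rewrite [RHS]ge0_integral_gauss.
- apply: eq_integral => x _; rewrite !patchE; case: ifPn => _; first by rewrite mul1e.
  by rewrite mul0e.
- by apply/(measurable_restrictT _ mA).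
- by move=> x; rewrite patchE; case: ifPn.
Qed.

End gauss.

Section gauss_rotation.
Context {R : realType}.
Local Notation T := (measurableTypeR R).
Local Notation normal := (@normal_prob R 0 1).
Local Open Scope ereal_scope.

Definition tdot m (x y : m.-tuple T) : R := (\sum_i tnth x i * tnth y i)%R.

Lemma tdot_cons m (a b : T) (x y : m.-tuple T) :
  tdot (tuple_cons (a, x)) (tuple_cons (b, y)) = (a * b + tdot x y)%R.
Proof.
rewrite /tdot big_ord_recl; congr (_ + _)%R.
by apply: eq_bigr => i _; rewrite !tnthS.
Qed.

Lemma tdotxx_ge0 m (x : m.-tuple T) : (0 <= tdot x x)%R.
Proof. by apply: sumr_ge0 => i _; rewrite -expr2 sqr_ge0. Qed.

Lemma measurable_tdot_comp d (U : measurableType d) m (f g : U -> m.-tuple T) :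
  measurable_fun setT f -> measurable_fun setT g ->
  measurable_fun setT (fun u => tdot (f u) (g u) : T).
Proof.
move=> /measurable_fun_tnthP mf /measurable_fun_tnthP mg.
by apply: measurable_sum => i; apply: measurable_funM; [exact: mf|exact: mg].
Qed.

Lemma measurable_tdot m (x : m.-tuple T) :
  measurable_fun setT (tdot x : m.-tuple T -> T).
Proof. by apply: (measurable_tdot_comp (f := cst x) (g := id)). Qed.

Lemma measurable_tdotxx m :
  measurable_fun setT (fun x : m.-tuple T => tdot x x : T).
Proof. by apply: (measurable_tdot_comp (f := id) (g := id)). Qed.

Lemma tuple_consE m (y : m.+1.-tuple T) :
  y = tuple_cons (tnth y ord0, [tuple of behead y]).
Proof. by rewrite [LHS]tuple_eta; exact: val_inj. Qed.

Lemma tnth_tuple_cons0 m (p : T * m.-tuple T) : tnth (tuple_cons p) ord0 = p.1.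
Proof. by []. Qed.

Lemma measurable_fun_tuple0 (f : 0.-tuple T -> \bar R) : measurable_fun setT f.
Proof.
have -> : f = cst (f [tuple]) by apply/funext => t; rewrite (tuple0 t).
exact: measurable_cst.
Qed.

Lemma ge0_integral_gaussS m (f : m.+1.-tuple T -> \bar R) :
  measurable_fun setT f -> (forall x, 0 <= f x) ->
  \int[gauss m.+1]_y f y =
  \int[normal]_b \int[gauss m]_t f (tuple_cons (b, t)).
Proof. exact: ge0_integral_tuple_prod. Qed.

Lemma ge0_integral_normalN (f : T -> \bar R) : measurable_fun setT f ->
  (forall x, 0 <= f x) -> \int[normal]_x f (- x)%R = \int[normal]_x f x.
Proof.
move=> mf f0; have mN : measurable_fun setT (fun x : T => f (- x)%R).
  by apply: measurableT_comp => //; exact: measurable_oppr.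
have mp : measurable_fun setT (fun y : T => (normal_pdf 0 1 y)%:E).
  by apply/measurable_EFinP; exact: (@measurable_normal_pdf R 0 1).
rewrite !ge0_integral_normal// [RHS](@ge0_integral_affine _ (- 1)%R 0%R).
- rewrite normrN1 mul1e; apply: eq_integral => x _.
  by rewrite /affine mulN1r addr0 !normal_pdf01E sqrrN.
- by rewrite oppr_eq0 oner_neq0.
- exact: emeasurable_funM.
- by move=> x; rewrite mule_ge0// lee_fin normal_pdf_ge0.
Qed.

(** Against the Gaussian measure the linear form given by [x] behaves as the first
    coordinate scaled by the norm of [x]: the induction hypothesis collects the tail of
    [x] into its first coordinate, and a planar rotation then merges the first two
    coordinates. *)
Lemma ge0_integral_gauss_dot m (x : m.+1.-tuple T) (F : T * T -> \bar R) :
  measurable_fun setT F -> (forall p, 0 <= F p) ->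
  \int[gauss m.+1]_y F (tdot x y, tdot y y) =
  \int[gauss m.+1]_y F (Num.sqrt (tdot x x) * tnth y ord0, tdot y y)%R.
Proof.
move=> mF F0; have mFu k (u : k.-tuple T -> T) : measurable_fun setT u ->
    measurable_fun setT (fun y => F (u y, tdot y y)).
  move=> mu; apply: measurableT_comp mF _; apply: measurable_fun_pair => //.
  exact: measurable_tdotxx.
have m0 (r : R) k : measurable_fun setT (fun y : k.+1.-tuple T => (r * tnth y ord0)%R : T).
  by apply: measurable_funM => //; exact: measurable_tnth.
elim: m x F mF F0 mFu => [|m IH] x F mF F0 mFu.
  rewrite !ge0_integral_gaussS//; last 2 first.
  - exact: (mFu _ _ (m0 _ _)).
  - exact: (mFu _ _ (measurable_tdot _)).
  rewrite (tuple_consE x); set a := tnth x ord0; set x' : 0.-tuple T := [tuple of _].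
  have t0 (y z : 0.-tuple T) : tdot y z = 0%R by rewrite /tdot big_ord0.
  pose f (c b : T) := F (c * b, b ^+ 2)%R.
  have mf c : measurable_fun setT (f c).
    apply: measurableT_comp mF _; apply: measurable_fun_pair.
      exact: measurable_funM.
    exact: measurable_funX.
  transitivity (\int[normal]_b f a b).
    apply: eq_integral => b _; rewrite /= integral_dirac//; last exact: measurable_fun_tuple0.
    by rewrite diracT mul1e !tdot_cons !t0 !addr0 -expr2.
  transitivity (\int[normal]_b f `|a|%R b); last first.
    apply: eq_integral => b _; rewrite /= integral_dirac//; last exact: measurable_fun_tuple0.
    by rewrite diracT mul1e !tdot_cons !t0 !addr0 -!expr2 sqrtr_sqr.
  have [a0|a0] := ler0P a; last by [].
  rewrite -(ge0_integral_normalN (mf a)) => [|b]; last exact: F0.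
  by apply: eq_integral => b _; rewrite /f mulrN mulNr sqrrN.
rewrite (tuple_consE x); set a := tnth x ord0; set x' : m.+1.-tuple T := [tuple of _].
rewrite !ge0_integral_gaussS//; last 2 first.
- exact: (mFu _ _ (m0 _ _)).
- exact: (mFu _ _ (measurable_tdot _)).
pose G (p : T * T) := \int[gauss m]_s F (p.1, p.2 + tdot s s)%R.
have mFG : measurable_fun setT
    (fun q : (T * T) * m.-tuple T => F (q.1.1, q.1.2 + tdot q.2 q.2)%R).
  apply: measurableT_comp mF _; apply: measurable_fun_pair.
    exact: measurableT_comp.
  apply: measurable_funD; first exact: measurableT_comp.
  exact: measurable_tdot_comp.
have mG : measurable_fun setT G.
  exact: (@measurable_fun_fubini_tonelli_F _ _ _ _ _ (gauss m) _ mFG (fun=> F0 _)).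
have G0 p : 0 <= G p by apply: integral_ge0 => s _; exact: F0.
have FG (u v w : R) : \int[gauss m.+1]_t F (u + v * tnth t ord0, w + tdot t t)%R =
    \int[normal]_c G (u + v * c, w + c ^+ 2)%R.
  rewrite ge0_integral_gaussS//; last first.
    apply: measurableT_comp mF _; apply: measurable_fun_pair.
      apply: measurable_funD => //; exact: m0.
    by apply: measurable_funD => //; exact: measurable_tdotxx.
  apply: eq_integral => c _; apply: eq_integral => s _.
  by rewrite tdot_cons addrA -expr2.
pose r' := Num.sqrt (tdot x' x').
transitivity (\int[normal]_b \int[normal]_c G (a * b + r' * c, b ^+ 2 + c ^+ 2)%R).
  apply: eq_integral => b _; rewrite -FG.
  pose Fb (p : T * T) := F (a * b + p.1, b ^+ 2 + p.2)%R.
  rewrite -(IH x' Fb)//.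
  - by apply: eq_integral => t _; rewrite !tdot_cons -expr2.
  - apply: measurableT_comp mF _; apply: measurable_fun_pair;
      exact: measurable_funD.
  - by move=> p; exact: F0.
  - move=> k u mu; apply: measurableT_comp mF _; apply: measurable_fun_pair.
      exact: measurable_funD.
    by apply: measurable_funD => //; exact: measurable_tdotxx.
rewrite ge0_integral_normal_rotation//.
apply: eq_integral => b _.
transitivity (\int[gauss m.+1]_t F (Num.sqrt (a ^+ 2 + r' ^+ 2) * b + 0 * tnth t ord0,
    b ^+ 2 + tdot t t)%R).
  by rewrite FG; apply: eq_integral => c _; rewrite mul0r addr0.
apply: eq_integral => t _.
by rewrite !tdot_cons -!expr2 mul0r addr0 sqr_sqrtr// tdotxx_ge0.
Qed.

End gauss_rotation.

(** * Isotropic random directions *)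

Section isotropic.
Context {R : realType}.
Local Notation T := (measurableTypeR R).
Local Open Scope ereal_scope.

(** The squared cosine of the angle between x and y is at least 1 - r: this is a
    closeness of the lines spanned by x and y, and it requires both of them to be
    nonzero. *)
Definition tclose m (r : R) (x y : m.-tuple T) : bool :=
  [&& 0 < tdot x x, 0 < tdot y y &
      (1 - r) * (tdot x x * tdot y y) <= tdot x y ^+ 2]%R.

(** Invariance of the law of the line spanned by Z under rotations, in the only form
    that is needed to compare two such laws: all the balls of the same radius around
    lines are equally likely. *)
Definition isotropic d (U : measurableType d) (P : probability U R) m
    (Z : U -> m.-tuple T) : Prop :=
  [/\ measurable_fun setT Z,
      P [set u | 0 < tdot (Z u) (Z u)]%R = 1 &
      forall r y y', (0 < tdot y y)%R -> (0 < tdot y' y')%R ->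
        P [set u | tclose r (Z u) y] = P [set u | tclose r (Z u) y']].

Lemma measurable_bool_set d (U : measurableType d) (b : U -> bool) :
  measurable_fun setT b -> measurable [set u | b u].
Proof.
move=> mb; rewrite -[X in measurable X]setTI.
exact: (mb measurableT [set true]).
Qed.

Lemma measurable_tclose d (U : measurableType d) m r (f g : U -> m.-tuple T) :
  measurable_fun setT f -> measurable_fun setT g ->
  measurable [set u | tclose r (f u) (g u)].
Proof.
move=> mf mg; apply: measurable_bool_set.
have mff := measurable_tdot_comp mf mf.
have mgg := measurable_tdot_comp mg mg.
apply: measurable_and; first exact: measurable_fun_ltr.
apply: measurable_and; first exact: measurable_fun_ltr.
apply: measurable_fun_ler.
  by apply: measurable_funM => //; exact: measurable_funM.
by apply: measurable_funX; exact: measurable_tdot_comp.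
Qed.

Lemma tcloseC m r (x y : m.-tuple T) : tclose r x y = tclose r y x.
Proof.
rewrite /tclose andbCA (mulrC (tdot x x)).
by rewrite (_ : tdot x y = tdot y x)//; apply: eq_bigr => i _; rewrite mulrC.
Qed.

Lemma measurable_preimage d d' (U : measurableType d) (V : measurableType d')
    (Z : U -> V) D : measurable_fun setT Z -> measurable D -> measurable (Z @^-1` D).
Proof. by move=> mZ mD; rewrite -[X in measurable X]setTI; exact: mZ. Qed.

Lemma probability_setI1 d (U : measurableType d) (P : probability U R) A N :
  measurable A -> measurable N -> P N = 1 -> P (A `&` N) = P A.
Proof.
move=> mA mN PN; rewrite [RHS](measureDI P mA mN).
rewrite [X in _ = X + _](_ : _ = 0) ?add0e//.
apply: (@subset_measure0 _ _ _ _ _ (~` N)).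
- exact: measurableD.
- exact: measurableC.
- by move=> x [].
- by transitivity (P (~` N)) => //; rewrite probability_setC// PN subee.
Qed.

Lemma measurable_tdot_gt0 d (U : measurableType d) m (Z : U -> m.-tuple T) :
  measurable_fun setT Z -> measurable [set u | 0 < tdot (Z u) (Z u)]%R.
Proof.
move=> mZ; apply: measurable_bool_set; apply: measurable_fun_ltr => //.
exact: measurable_tdot_comp.
Qed.

Lemma integral_tclose d1 (U1 : measurableType d1) (P1 : probability U1 R)
    d2 (U2 : measurableType d2) (P2 : probability U2 R) m
    (Z1 : U1 -> m.-tuple T) (Z2 : U2 -> m.-tuple T) (D : set (m.-tuple T))
    (r : R) (e : m.-tuple T) :
  isotropic P1 Z1 -> isotropic P2 Z2 -> measurable D -> (0 < tdot e e)%R ->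
  \int[P1]_u P2 [set v | tclose r (Z1 u) (Z2 v) /\ D (Z1 u)] =
  P2 [set v | tclose r (Z2 v) e] * P1 (Z1 @^-1` D).
Proof.
move=> [mZ1 Z10 _] [mZ2 _ iso2] mD e0.
have mD1 := measurable_preimage mZ1 mD.
have mN := measurable_tdot_gt0 mZ1.
rewrite -(probability_setI1 mD1 mN Z10).
rewrite -integral_cst//; last exact: measurableI.
rewrite [RHS]integral_mkcond; apply: eq_integral => u _; rewrite patchE.
case: ifPn => [/set_mem[/= Du Nu]|/negP uDN].
  rewrite -(iso2 r (Z1 u) e)//; congr (P2 _); apply/seteqP; split => v /=.
    by rewrite tcloseC => -[].
  by rewrite tcloseC.
rewrite (_ : [set v | _] = set0) ?measure0//; apply/seteqP; split => // v /=.
by move=> [/and3P[u0 _ _] Du]; apply: uDN; apply/mem_set.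
Qed.

(** This is the uniqueness argument for uniformly distributed measures. For independent
    Z1 and Z2 the probability that they are close can be computed by fixing either of
    them first; isotropy makes both inner probabilities constant, hence equal to a
    common c. Restricting to Z1 in A gives c P1(A), and closeness then puts Z2 in B, an
    event that contributes c P2(B). *)
Lemma isotropic_le d1 (U1 : measurableType d1) (P1 : probability U1 R)
    d2 (U2 : measurableType d2) (P2 : probability U2 R) m
    (Z1 : U1 -> m.-tuple T) (Z2 : U2 -> m.-tuple T) (A B : set (m.-tuple T))
    (r : R) (e : m.-tuple T) :
  isotropic P1 Z1 -> isotropic P2 Z2 -> measurable A -> measurable B ->
  (0 < tdot e e)%R ->
  (0 < P1 [set u | tclose r (Z1 u) e] \/ 0 < P2 [set u | tclose r (Z2 u) e]) ->
  (forall x y, A x -> tclose r x y -> B y) ->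
  P1 (Z1 @^-1` A) <= P2 (Z2 @^-1` B).
Proof.
move=> iso1 iso2 mA mB e0 c0 AB.
have [mZ1 _ _] := iso1; have [mZ2 _ _] := iso2.
pose X := [set p : U1 * U2 | tclose r (Z1 p.1) (Z2 p.2)].
have mX : measurable X.
  by apply: measurable_tclose; exact: measurableT_comp.
have int1 D : measurable D -> (P1 \x P2) (X `&` ((Z1 @^-1` D) `*` setT)) =
    P2 [set u | tclose r (Z2 u) e] * P1 (Z1 @^-1` D).
  move=> mD; rewrite -(integral_tclose r iso1 iso2 mD e0).
  apply: eq_integral => u _; congr (P2 _); apply/seteqP.
  rewrite /xsection; split => v /=; first by move=> /set_mem [cl []].
  by move=> [cl Du]; apply/mem_set.
have int2 D : measurable D -> (P1 \x P2) (X `&` (setT `*` (Z2 @^-1` D))) =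
    P1 [set u | tclose r (Z1 u) e] * P2 (Z2 @^-1` D).
  move=> mD; rewrite -(integral_tclose r iso2 iso1 mD e0).
  transitivity ((P1 \x^ P2) (X `&` (setT `*` (Z2 @^-1` D)))).
    apply: product_measure_unique => [*|]; first exact: product_measure2E.
    apply: measurableI => //; apply: measurableX => //; exact: measurable_preimage.
  apply: eq_integral => u _; congr (P1 _); apply/seteqP.
  rewrite /ysection; split => v /=.
    by move=> /set_mem [cl [_ Du]]; rewrite tcloseC.
  by rewrite tcloseC => -[cl Du]; apply/mem_set.
have c12 : P2 [set u | tclose r (Z2 u) e] = P1 [set u | tclose r (Z1 u) e].
  have := int1 setT measurableT; have := int2 setT measurableT.
  by rewrite !preimage_setT !probability_setT !mule1 => -> ->.
have c10 : 0 < P1 [set u | tclose r (Z1 u) e] by case: c0; rewrite ?c12.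
have c1y : P1 [set u | tclose r (Z1 u) e] \is a fin_num.
  by apply: fin_num_measure; apply: measurable_tclose => //; exact: measurable_cst.
rewrite -(lee_pmul2l c1y c10) -{1}c12 -int1// -int2//; apply: le_measure.
- rewrite inE; apply: measurableI => //; apply: measurableX => //.
  exact: measurable_preimage.
- rewrite inE; apply: measurableI => //; apply: measurableX => //.
  exact: measurable_preimage.
- by move=> [u v] [/= cl [/= Au _]]; split => //; split => //=; exact: AB Au cl.
Qed.

End isotropic.

Section quadratic_cone.
Context {R : realType}.
Local Notation T := (measurableTypeR R).

(** For delta = 0 a closed cone cut out by diagonal quadratic forms; a positive delta
    opens it by a small angle. *)
Definition qcone m (I : finType) (a : I -> 'I_m -> R) (delta : R) :
    set (m.-tuple T) :=
  [set y | forall i, \sum_l a i l * tnth y l ^+ 2 <= delta * tdot y y].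

Lemma measurable_forall d (U : measurableType d) (I : finType) (A : I -> set U) :
  (forall i, measurable (A i)) -> measurable [set u | forall i, A i u].
Proof.
move=> mA; rewrite (_ : [set u | _] = \bigcap_(i in [set: I]) A i).
  by apply: fin_bigcap_measurable => //; exact: finite_setT.
by apply/seteqP; split => u /= Au; [move=> i _|move=> i]; exact: Au.
Qed.

Lemma measurable_qcone m (I : finType) (a : I -> 'I_m -> R) delta :
  measurable (qcone a delta).
Proof.
apply: measurable_forall => i; apply: measurable_bool_set.
apply: measurable_fun_ler; last first.
  by apply: measurable_funM => //; exact: measurable_tdotxx.
apply: measurable_sum => l; apply: measurable_funM => //.
by apply: measurable_funX; exact: measurable_tnth.
Qed.

Lemma tdot_lagrange m (x y : m.-tuple T) :
  \sum_i \sum_j (tnth x i * tnth y j - tnth x j * tnth y i) ^+ 2 =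
  2 * (tdot x x * tdot y y - tdot x y ^+ 2).
Proof.
have E1 : tdot x x * tdot y y =
    \sum_i \sum_j (tnth x i * tnth x i) * (tnth y j * tnth y j).
  by rewrite /tdot big_distrlr.
have E2 : tdot x x * tdot y y =
    \sum_i \sum_j (tnth x j * tnth x j) * (tnth y i * tnth y i).
  by rewrite E1 exchange_big.
have E3 : tdot x y ^+ 2 =
    \sum_i \sum_j (tnth x i * tnth y i) * (tnth x j * tnth y j).
  by rewrite expr2 /tdot big_distrlr.
rewrite (_ : 2 * _ = tdot x x * tdot y y + tdot x x * tdot y y -
  2 * tdot x y ^+ 2); last by ring.
rewrite {1}E1 E2 E3 mulr_sumr -big_split -sumrB; apply: eq_bigr => i _ /=.
rewrite mulr_sumr -big_split -sumrB; apply: eq_bigr => j _ /=.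
by ring.
Qed.

Lemma tdot_cross_le m (x y : m.-tuple T) i j :
  (tnth x i * tnth y j - tnth x j * tnth y i) ^+ 2 <=
  2 * (tdot x x * tdot y y - tdot x y ^+ 2).
Proof.
rewrite -tdot_lagrange (bigD1 i)//= (bigD1 j)//= -addrA lerDl addr_ge0//.
  by apply: sumr_ge0 => l _; exact: sqr_ge0.
by apply: sumr_ge0 => k _; apply: sumr_ge0 => l _; exact: sqr_ge0.
Qed.

Lemma sqr_tnth_le m (x : m.-tuple T) i : tnth x i ^+ 2 <= tdot x x.
Proof.
rewrite /tdot (bigD1 i)//= -expr2 lerDl; apply: sumr_ge0 => l _.
by rewrite -expr2 sqr_ge0.
Qed.

(** By Lagrange's identity the cross differences of two close vectors are small; a
    difference of products of squares factors through a cross difference. *)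
Lemma tclose_sqr m (rho : R) (x y : m.-tuple T) i j : 0 <= rho ->
  tclose (rho ^+ 2 / 2) x y ->
  `|tnth x i ^+ 2 * tnth y j ^+ 2 - tnth x j ^+ 2 * tnth y i ^+ 2| <=
  2 * rho * (tdot x x * tdot y y).
Proof.
move=> rho0 /and3P[x0 y0]; set N := tdot x x * tdot y y => cl.
have N0 : 0 <= N by rewrite mulr_ge0// ltW.
have cr : (tnth x i * tnth y j - tnth x j * tnth y i) ^+ 2 <= rho ^+ 2 * N.
  by apply: le_trans (tdot_cross_le x y i j) _; rewrite -/N; lra.
have cs : (tnth x i * tnth y j + tnth x j * tnth y i) ^+ 2 <= 4 * N.
  have h (u v : R) : (u + v) ^+ 2 <= 2 * (u ^+ 2 + v ^+ 2).
    by have := sqr_ge0 (u - v); rewrite !expr2; lra.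
  apply: le_trans (h _ _) _.
  have : (tnth x i * tnth y j) ^+ 2 <= N.
    by rewrite exprMn ler_pM ?sqr_ge0 ?sqr_tnth_le.
  have : (tnth x j * tnth y i) ^+ 2 <= N.
    by rewrite exprMn ler_pM ?sqr_ge0 ?sqr_tnth_le.
  lra.
set D := _ - _.
suff : `|D| ^+ 2 <= (2 * rho * N) ^+ 2.
  have N20 : 0 <= 2 * rho * N by rewrite mulr_ge0// mulr_ge0.
  by rewrite ler_pXn2r.
rewrite real_normK ?num_real// (_ : D = (tnth x i * tnth y j - tnth x j * tnth y i) *
  (tnth x i * tnth y j + tnth x j * tnth y i)); last by rewrite /D; ring.
rewrite exprMn (_ : (2 * _ * _) ^+ 2 = rho ^+ 2 * N * (4 * N)); last by ring.
by rewrite ler_pM ?sqr_ge0.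
Qed.

Lemma tclose_qcone m (I : finType) (a : I -> 'I_m -> R) delta : 0 < delta ->
  exists2 r, 0 < r & forall x y, qcone a 0 x -> tclose r x y -> qcone a delta y.
Proof.
move=> d0; pose A := \sum_i \sum_l `|a i l|.
have A0 : 0 <= A by apply: sumr_ge0 => i _; apply: sumr_ge0.
pose C := 2 * m%:R * A + 1.
have C0 : 0 < C by rewrite ltr_wpDl// !mulr_ge0.
pose rho := delta / C.
have rho0 : 0 < rho by rewrite divr_gt0.
exists (rho ^+ 2 / 2); first by rewrite divr_gt0// exprn_gt0.
move=> x y qx cl i; have /and3P[x0 y0 _] := cl.
have := qx i; rewrite mul0r => qxi.
rewrite -(ler_pM2l x0).
set N := tdot x x * tdot y y.
have N0 : 0 < N by rewrite mulr_gt0.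
have clo l : `|tnth x l ^+ 2 * tdot y y - tnth y l ^+ 2 * tdot x x| <=
    2 * rho * m%:R * N.
  rewrite /tdot !mulr_sumr -sumrB.
  apply: le_trans (ler_norm_sum _ _ _) _.
  rewrite (_ : _ * N = \sum_(j < m) 2 * rho * N); last first.
    by rewrite sumr_const card_ord -mulr_natr; ring.
  apply: ler_sum => j _; apply: le_trans (tclose_sqr l j (ltW rho0) cl).
  by rewrite -!expr2 (mulrC (tnth y l ^+ 2)).
have -> : tdot x x * (\sum_l a i l * tnth y l ^+ 2) =
    tdot y y * (\sum_l a i l * tnth x l ^+ 2) -
    \sum_l a i l * (tnth x l ^+ 2 * tdot y y - tnth y l ^+ 2 * tdot x x).
  by rewrite !mulr_sumr -sumrB; apply: eq_bigr => l _; ring.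
have h1 : tdot y y * (\sum_l a i l * tnth x l ^+ 2) <= 0 by rewrite pmulr_rle0.
have h2 : `|\sum_l a i l * (tnth x l ^+ 2 * tdot y y - tnth y l ^+ 2 * tdot x x)|
    <= A * (2 * rho * m%:R * N).
  apply: le_trans (ler_norm_sum _ _ _) _.
  apply: (@le_trans _ _ (\sum_l `|a i l| * (2 * rho * m%:R * N))).
    by apply: ler_sum => l _; rewrite normrM ler_wpM2l.
  rewrite -mulr_suml ler_wpM2r//.
    by rewrite mulr_ge0 ?(ltW N0)// mulr_ge0// mulr_ge0// ltW.
  by rewrite /A [leRHS](bigD1 i)//= lerDl; apply: sumr_ge0 => k _; exact: sumr_ge0.
have h3 : A * (2 * rho * m%:R * N) <= tdot x x * (delta * tdot y y).
  rewrite (_ : tdot x x * _ = delta * N); last by rewrite /N; ring.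
  rewrite (_ : A * _ = (2 * m%:R * A) * rho * N); last by ring.
  rewrite ler_pM2r// /rho mulrCA ger_pMr// ler_pdivrMr// mul1r /C.
  by rewrite lerDl.
move: h2; rewrite ler_norml => /andP[h2 _].
by lra.
Qed.

Local Open Scope ereal_scope.

(** Every opening of the cone is comparable to the cone itself, and the openings
    decrease to the cone. *)
Lemma isotropic_qcone_le d1 (U1 : measurableType d1) (P1 : probability U1 R)
    d2 (U2 : measurableType d2) (P2 : probability U2 R) m
    (Z1 : U1 -> m.-tuple T) (Z2 : U2 -> m.-tuple T)
    (I : finType) (a : I -> 'I_m -> R) (e : m.-tuple T) :
  isotropic P1 Z1 -> isotropic P2 Z2 -> (0 < tdot e e)%R ->
  (forall r, (0 < r)%R -> 0 < P1 [set u | tclose r (Z1 u) e] \/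
    0 < P2 [set u | tclose r (Z2 u) e]) ->
  P1 (Z1 @^-1` qcone a 0) <= P2 (Z2 @^-1` qcone a 0).
Proof.
move=> iso1 iso2 e0 pos.
have [mZ2 _ _] := iso2.
pose F n := Z2 @^-1` qcone a n.+1%:R^-1%R.
have mF n : measurable (F n).
  by apply: measurable_preimage => //; exact: measurable_qcone.
have capF : \bigcap_n F n = Z2 @^-1` qcone a 0.
  apply/seteqP; split => u /= Fu i.
    apply/ler_addgt0Pl => eps eps0.
    set N := tdot (Z2 u) (Z2 u).
    have N0 : (0 <= N)%R := tdotxx_ge0 _.
    have [n Nn] : exists n, (N < eps * n.+1%:R)%R.
      exists (Num.truncn (N / eps)).
      by rewrite mulrC -ltr_pdivrMr// truncnS_gt.
    apply: le_trans (Fu n Logic.I i) _; rewrite -/N mul0r addr0.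
    by rewrite mulrC ler_pdivrMr// ltW.
  move=> _ j; apply: le_trans (Fu j) _.
  by rewrite mul0r mulr_ge0// tdotxx_ge0.
have cvgF : P2 (F n) @[n --> \oo] --> P2 (Z2 @^-1` qcone a 0).
  rewrite -capF; apply: nonincreasing_cvg_mu => //.
  - by rewrite ltey_eq fin_num_measure.
  - exact: bigcap_measurableType.
  - move=> p q pq; apply/subsetPset => u /= qu i; apply: le_trans (qu i) _.
    by rewrite ler_wpM2r ?tdotxx_ge0// lef_pV2 ?posrE// ler_nat.
rewrite -(cvg_lim _ cvgF)//; apply: lime_ge.
  by apply/cvg_ex; eexists; exact: cvgF.
apply: nearW => n.
have [|r r0 cl] := @tclose_qcone m I a n.+1%:R^-1%R; first by rewrite invr_gt0.
apply: (isotropic_le iso1 iso2 _ _ e0 (pos r r0) cl); exact: measurable_qcone.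
Qed.

End quadratic_cone.

(** * Gaussian measure of cones *)

Section gauss_isotropic.
Context {R : realType}.
Local Notation T := (measurableTypeR R).
Local Notation leb := (@lebesgue_measure R).
Local Notation normal := (@normal_prob R 0 1).
Local Open Scope ereal_scope.

Definition gauss_prob m : set (m.-tuple T) -> \bar R := gauss m.
HB.instance Definition _ m := Measure.copy (@gauss_prob m) (gauss m).
HB.instance Definition _ m :=
  Measure_isProbability.Build _ _ _ (@gauss_prob m) (gauss_setT m).

Lemma gauss_consE m (A : set (m.+1.-tuple T)) : measurable A ->
  gauss m.+1 A = \int[normal]_x gauss m [set t | A (tuple_cons (x, t))].
Proof.
move=> mA; rewrite /= /tuple_prod /pushforward.
apply: eq_integral => x _; congr (gauss m _).
by rewrite /xsection; apply/seteqP; split => t /=; [move/set_mem|move=> ?; exact/mem_set].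
Qed.

Lemma gauss_consE2 m (A : set (m.+1.-tuple T)) : measurable A ->
  gauss m.+1 A = \int[gauss m]_t normal [set x | A (tuple_cons (x, t))].
Proof.
move=> mA.
have mA' : measurable (@tuple_cons _ T m @^-1` A).
  by apply: measurable_preimage => //; exact: measurable_tuple_cons.
transitivity ((normal \x^ gauss m) (@tuple_cons _ T m @^-1` A)).
  rewrite /= /tuple_prod /pushforward.
  by apply: product_measure_unique => // *; exact: product_measure2E.
apply: eq_integral => t _; congr (normal _).
by rewrite /ysection; apply/seteqP; split => x /=; [move/set_mem|move=> ?; exact/mem_set].
Qed.

Lemma normal_null (A : set T) : measurable A -> leb A = 0 -> normal A = 0.
Proof.
move=> mA A0; have /null_content_dominatesP := @normal_prob_dominates R 0 1.
exact.
Qed.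

Lemma normal_set1 (x : R) : normal [set x] = 0.
Proof. by apply: normal_null => //; exact: lebesgue_measure_set1. Qed.

Lemma gauss_cons_setX m (A : set T) (B : set (m.-tuple T)) :
  measurable A -> measurable B ->
  gauss m.+1 [set y | A (tnth y ord0) /\ B [tuple of behead y]] =
  normal A * gauss m B.
Proof.
move=> mA mB; rewrite /= /tuple_prod /pushforward.
rewrite -product_measure1E//; congr (product_measure1 _ _ _).
apply/seteqP; split => -[x t] /= [Ax Bt]; split => //.
  by rewrite (_ : t = [tuple of behead (tuple_cons (x, t))])//; exact: val_inj.
by rewrite (_ : [tuple of behead (tuple_cons (x, t))] = t)//; exact: val_inj.
Qed.

Lemma gauss_dot_set m (x : m.+1.-tuple T) (S : set (T * T)) : measurable S ->
  gauss m.+1 [set y | S (tdot x y, tdot y y)] =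
  gauss m.+1 [set y | S (Num.sqrt (tdot x x) * tnth y ord0, tdot y y)%R].
Proof.
move=> mS.
have mp (u : m.+1.-tuple T -> T) : measurable_fun setT u ->
    measurable [set y | S (u y, tdot y y)].
  move=> mu; apply: (@measurable_preimage _ _ _ _ (fun y => (u y, tdot y y))) => //.
  by apply: measurable_fun_pair => //; exact: measurable_tdotxx.
have m0 : measurable_fun setT
    (fun y : m.+1.-tuple T => Num.sqrt (tdot x x) * tnth y ord0 : T)%R.
  by apply: measurable_funM => //; exact: measurable_tnth.
have E (A : set (m.+1.-tuple T)) : measurable A -> gauss m.+1 A = \int[gauss m.+1]_y (\1_A y)%:E.
  by move=> mA; rewrite integral_indic// setIT.
rewrite (E _ (mp _ (measurable_tdot x))) (E _ (mp _ m0)).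
have := @ge0_integral_gauss_dot R m x (fun p => (\1_S p)%:E).
by apply => [|p]; [exact/measurable_EFinP/measurable_indic|rewrite lee_fin].
Qed.

(** The right-hand side does not mention x: this is the isotropy of the Gaussian
    measure. *)
Lemma gauss_tclose m r (x : m.+1.-tuple T) : (0 < tdot x x)%R ->
  gauss m.+1 [set y | tclose r y x] =
  gauss m.+1 [set y | (0 < tdot y y)%R && ((1 - r) * tdot y y <= tnth y ord0 ^+ 2)%R].
Proof.
move=> x0.
pose S := [set p : T * T | (0 < p.2)%R &&
  ((1 - r) * (p.2 * tdot x x) <= p.1 ^+ 2)%R].
have mS : measurable S.
  apply: measurable_bool_set; apply: measurable_and; first exact: measurable_fun_ltr.
  apply: measurable_fun_ler; last exact: measurable_funX.
  by apply: measurable_funM => //; exact: measurable_funM.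
transitivity (gauss m.+1 [set y | S (tdot x y, tdot y y)]).
  congr (gauss _ _); apply/seteqP.
  by split => y /=; rewrite tcloseC /tclose x0 /= (mulrC (tdot x x)).
rewrite gauss_dot_set//; congr (gauss _ _); apply/seteqP.
have h y : ((1 - r) * (tdot y y * tdot x x) <=
    (Num.sqrt (tdot x x) * tnth y ord0) ^+ 2 =
    ((1 - r) * tdot y y <= tnth y ord0 ^+ 2))%R.
  by rewrite exprMn sqr_sqrtr ?tdotxx_ge0// mulrA mulrC ler_pM2l.
by split => y; rewrite /S /= h.
Qed.

Lemma normal_itv_gt0 (a b : R) : (a < b)%R -> 0 < normal `[a, b].
Proof.
move=> ab; pose c := (normal_peak 1 * expR (- (a ^+ 2 + b ^+ 2) / 2))%R : R.
have c0 : (0 < c)%R by rewrite mulr_gt0 ?expR_gt0// normal_peak_gt0// oner_neq0.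
apply: (@lt_le_trans _ _ (\int[leb]_(x in `[a, b]) c%:E)).
  rewrite integral_cst//= lebesgue_measure_itv/= lte_fin ab -EFinB -EFinM lte_fin.
  by rewrite mulr_gt0// subr_gt0.
apply: ge0_le_integral => //.
- by move=> x _; rewrite lee_fin ltW.
- apply/measurable_EFinP/measurable_funTS; exact: (@measurable_normal_pdf R 0 1).
- move=> x /=; rewrite in_itv/= => /andP[ax xb].
  rewrite lee_fin normal_pdf01E /c ler_pM2l ?normal_peak_gt0 ?oner_neq0//.
  rewrite ler_expR ler_pM2r ?invr_gt0// lerN2.
  have [x0|x0] := leP 0%R x.
    by rewrite (@le_trans _ _ (b ^+ 2)%R)// ?ler_wpDl ?sqr_ge0// ler_pXn2r ?nnegrE// (le_trans x0).
  rewrite (@le_trans _ _ (a ^+ 2)%R) ?ler_wpDr ?sqr_ge0//.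
  by rewrite -(sqrrN x) -(sqrrN a) ler_pXn2r ?nnegrE ?oppr_ge0 ?lerN2// ltW// (le_lt_trans ax).
Qed.

Lemma gauss_box_gt0 m (eta : R) : (0 < eta)%R ->
  0 < gauss m [set y | forall j, (tnth y j ^+ 2 <= eta)%R].
Proof.
move=> eta0; elim: m => [|m IH].
  rewrite (_ : [set y | _] = setT) ?gauss_setT// ?lte01//.
  by apply/seteqP; split => // y _ [].
pose A := [set x : T | (x ^+ 2 <= eta)%R].
have mA : measurable A.
  by apply: measurable_bool_set; apply: measurable_fun_ler => //; exact: measurable_funX.
have mB : measurable [set y : m.-tuple T | forall j, (tnth y j ^+ 2 <= eta)%R].
  apply: measurable_forall => j; apply: measurable_bool_set.
  by apply: measurable_fun_ler => //; apply: measurable_funX; exact: measurable_tnth.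
rewrite (_ : [set y | _] = [set y | A (tnth y ord0) /\
    [set y : m.-tuple T | forall j, (tnth y j ^+ 2 <= eta)%R] [tuple of behead y]]).
  rewrite gauss_cons_setX// mule_gt0//.
  have s0 : (0 < Num.sqrt eta)%R by rewrite sqrtr_gt0.
  apply: lt_le_trans (normal_itv_gt0 s0) _; apply: le_measure; rewrite ?inE//.
  move=> x /=; rewrite in_itv/= /A /= => /andP[x0 xs].
  by rewrite -(sqr_sqrtr (ltW eta0)) ler_pXn2r ?nnegrE// ltW.
apply/seteqP; split => y /=; rewrite {1}(tuple_consE y).
  move=> ye; split => [|j]; first exact: (ye ord0).
  by have := ye (lift ord0 j); rewrite tnthS.
move=> [y0 yj] j; rewrite (tuple_consE y).
by have [i ->|->] := unliftP ord0 j; [rewrite tnthS; exact: yj|exact: y0].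
Qed.

(** The box where the first coordinate lies in [1, 2] and the squares of the others are
    at most r / (m + 1) is inside the cap around the first axis. *)
Lemma gauss_tclose_gt0 m r (x : m.+1.-tuple T) : (0 < r)%R -> (0 < tdot x x)%R ->
  0 < gauss m.+1 [set y | tclose r y x].
Proof.
move=> r0 x0.
pose eta := (r / m.+1%:R)%R.
have eta0 : (0 < eta)%R by rewrite divr_gt0.
pose B := [set y : m.-tuple T | forall j, (tnth y j ^+ 2 <= eta)%R].
have mB : measurable B.
  apply: measurable_forall => j; apply: measurable_bool_set.
  by apply: measurable_fun_ler => //; apply: measurable_funX; exact: measurable_tnth.
have mA : measurable (`[1%R, 2%R]%classic : set T) by exact: measurable_itv.
have AB0 : 0 < normal `[1%R, 2%R] * gauss m B.
  by rewrite mule_gt0 ?gauss_box_gt0// normal_itv_gt0// ltr1n.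
apply: (lt_le_trans AB0); rewrite -gauss_cons_setX// gauss_tclose//.
apply: le_measure; rewrite ?inE.
- apply: measurableI; last first.
    apply: measurable_preimage mB; exact: measurable_behead.
  by apply: measurable_preimage mA; exact: measurable_tnth.
- apply: measurable_bool_set; apply: measurable_and.
    by apply: measurable_fun_ltr => //; exact: measurable_tdotxx.
  apply: measurable_fun_ler.
    by apply: measurable_funM => //; exact: measurable_tdotxx.
  by apply: measurable_funX; exact: measurable_tnth.
- move=> y [/=]; rewrite in_itv/= => /andP[y1 _] By.
  have y12 : (1 <= tnth y ord0 ^+ 2)%R by rewrite exprn_ege1.
  have -> : tdot y y = (tnth y ord0 ^+ 2 + tdot [tuple of behead y] [tuple of behead y])%R.
    by rewrite {1 2}(tuple_consE y) tdot_cons expr2.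
  set t := [tuple of behead y]; set a := (tnth y ord0 ^+ 2)%R.
  have t0 := tdotxx_ge0 t.
  have tr : (tdot t t <= r)%R.
    apply: (@le_trans _ _ (\sum_(j < m) eta)%R).
      by apply: ler_sum => j _; rewrite -expr2; exact: By.
    rewrite sumr_const card_ord -mulr_natr /eta -mulrA ger_pMr//.
    by rewrite mulrC ler_pdivrMr// mul1r ler_nat.
  apply/andP; split; first by rewrite ltr_pwDl// (lt_le_trans ltr01).
  have h : (tdot t t <= r * a + r * tdot t t)%R.
    by apply: le_trans tr _; rewrite -[leLHS]mulr1 -mulrDr ler_pM2l// ler_wpDr.
  by lra.
Qed.

Lemma isotropic_gauss m : isotropic (@gauss_prob m.+1) id.
Proof.
split => [//||r y y' y0 y0'].
  have mN := @measurable_tdot_gt0 R _ _ m.+1 id (@measurable_id _ _ _).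
  pose N0 := [set y : m.+1.-tuple T | (tnth y ord0 = 0)%R].
  have mN0 : measurable N0.
    apply: (@measurable_preimage _ _ _ _ (fun y : m.+1.-tuple T => tnth y ord0) [set 0%R]) => //.
    exact: measurable_tnth.
  have N00 : gauss m.+1 N0 = 0.
    have := @gauss_cons_setX m [set 0%R] setT (measurable_set1 _) measurableT.
    rewrite normal_set1 mul0e => <-; congr (gauss _ _).
    by apply/seteqP; split => y //= [].
  have N1 : gauss_prob (~` N0) = 1.
    by rewrite probability_setC// [X in _ - X](_ : _ = 0) ?sube0.
  apply/eqP; rewrite eq_le probability_le1 ?andTb; last exact: mN.
  apply: (@le_trans _ _ (gauss_prob (~` N0))); first by rewrite N1.
  apply: le_measure; rewrite ?inE.
  - exact: measurableC.
  - exact: mN.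
  move=> y /= y0; rewrite lt_neqAle tdotxx_ge0 andbT eq_sym.
  apply/eqP => yy; apply: y0; apply/eqP; rewrite -sqrf_eq0 eq_le sqr_ge0 andbT.
  by rewrite -yy sqr_tnth_le.
transitivity (gauss m.+1 [set u | tclose r u y]); first by [].
by rewrite gauss_tclose// -(gauss_tclose r y0').
Qed.

End gauss_isotropic.

Section gauss_cone.
Context {R : realType}.
Local Notation T := (measurableTypeR R).
Local Notation leb := (@lebesgue_measure R).
Local Notation normal := (@normal_prob R 0 1).
Local Open Scope ereal_scope.

Lemma ge0_integral_even (f : T -> \bar R) : measurable_fun setT f ->
  (forall x, 0 <= f x) -> (forall x, f (- x)%R = f x) ->
  \int[leb]_x f x = 2%:E * \int[leb]_(x in `[0%R, +oo[) f x.
Proof.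
move=> mf f0 fN.
rewrite -(setUv (`[0%R, +oo[%classic : set T)) ge0_integral_setU//=; last 3 first.
- exact: measurableC.
- by rewrite setUv.
- exact/disj_setPCl.
rewrite mule_natl mule2n; congr +%E.
rewrite setCitvr integral_itv_bndo_bndc; last exact: measurable_funTS.
rewrite ge0_integration_by_substitution0//.
by apply: eq_integral => /= x _; rewrite fN.
Qed.

Lemma measurable_cone p (k : R) : measurable [set y : p.+1.-tuple T |
  forall j : 'I_p, (k * tnth y (lift ord0 j) ^+ 2 <= tnth y ord0 ^+ 2)%R].
Proof.
apply: measurable_forall => j; apply: measurable_bool_set.
apply: measurable_fun_ler.
  by apply: measurable_funM => //; apply: measurable_funX; exact: measurable_tnth.
by apply: measurable_funX; exact: measurable_tnth.
Qed.

(** Conditionally on the first coordinate x the cone condition says that the other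
    coordinates lie in a cube of half-side |x| / sqrt k; the substitution x = sqrt k t
    gives the integral. *)
Lemma gauss_cone p k : (0 < k)%N ->
  gauss p.+1 [set y : p.+1.-tuple T |
    forall j : 'I_p, (k%:R * tnth y (lift ord0 j) ^+ 2 <= tnth y ord0 ^+ 2)%R] =
  (Num.sqrt (2 * k%:R / pi))%:E * \int[leb]_(t in `[0%R, +oo[)
    ((expR (- (k%:R * t ^+ 2) / 2))%:E * gaussian (cube_tuple p t)).
Proof.
move=> k0; set C := [set y | _].
have mC : measurable C by exact: measurable_cone.
have k0R : (0 < k%:R :> R)%R by rewrite ltr0n.
have sk0 : (0 < Num.sqrt k%:R :> R)%R by rewrite sqrtr_gt0.
rewrite gauss_consE//.
pose f (x : T) := gauss p [set t | C (tuple_cons (x, t))].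
have mf : measurable_fun setT f.
  have mC' : measurable (@tuple_cons _ T p @^-1` C).
    exact: (measurable_preimage (@measurable_tuple_cons _ T p) mC).
  rewrite (_ : f = gauss p \o xsection (@tuple_cons _ T p @^-1` C)).
    exact: measurable_fun_xsection.
  by apply/funext => x; rewrite /= xsectionE.
have f0 x : 0 <= f x by exact: measure_ge0.
rewrite (@ge0_integral_normal R f)//.
have mp : measurable_fun setT (fun y : T => (normal_pdf 0 1 y)%:E).
  by apply/measurable_EFinP; exact: (@measurable_normal_pdf R 0 1).
pose g (x : T) := f x * (normal_pdf 0 1 x)%:E.
have mg : measurable_fun setT g by exact: emeasurable_funM.
have g0 x : 0 <= g x by rewrite mule_ge0// lee_fin normal_pdf_ge0.
have fE x t : (0 <= t)%R -> (x ^+ 2 = k%:R * t ^+ 2)%R ->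
    f x = gaussian (cube_tuple p t : set (p.-tuple T)).
  move=> t0 xt.
  have -> : cube_tuple p t = [set y | C (tuple_cons (x, y))].
    apply/seteqP; split => y /= yt j; have := yt j; rewrite tnthS tnth_tuple_cons0 /=
      xt ler_pM2l// -(real_normK (num_real (tnth y j))) ler_pXn2r ?nnegrE//.
  rewrite gaussianE//.
  have := measurable_preimage (@measurable_tuple_cons _ T p) mC.
  by move/(measurable_xsection x); rewrite xsectionE.
have fN x : f (- x)%R = f x.
  rewrite /f /C; congr (gauss p _); apply/seteqP.
  by split => t /= Ct j; have := Ct j; rewrite !tnthS !tnth_tuple_cons0 /= sqrrN.
pose s : R := Num.sqrt k%:R.
rewrite (@ge0_integral_affine _ s 0%R g)//; last by rewrite gt_eqF.
rewrite ge0_integral_even//; last 2 first.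
- by apply: measurableT_comp => //; exact: measurable_affine.
- by move=> x; rewrite /g /affine !addr0 mulrN fN !normal_pdf01E sqrrN.
rewrite gtr0_norm// muleA -EFinM.
transitivity ((s * 2)%:E * \int[leb]_(t in `[0%R, +oo[) ((normal_peak 1)%:E *
    ((expR (- (k%:R * t ^+ 2) / 2))%:E * gaussian (cube_tuple p t)))).
  congr (_ * _); apply: eq_integral => t; rewrite inE/= in_itv/= andbT => t0.
  rewrite /g /affine addr0 (fE _ t)//; last by rewrite exprMn sqr_sqrtr// ltW.
  by rewrite normal_pdf01E exprMn sqr_sqrtr ?(ltW k0R)// EFinM [LHS]muleC -muleA.
rewrite ge0_integralZl//; last 3 first.
- rewrite (_ : (fun t => _) = fun t : T => (expR (- (k%:R * t ^+ 2) / 2))%:E *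
    gaussian (cube_tuple p t)) //.
  apply: emeasurable_funM.
    apply/measurable_EFinP/measurable_funTS; apply: measurableT_comp => //.
    apply: measurable_funM => //; apply: measurableT_comp => //.
    by apply: measurable_funM => //; exact: measurable_funX.
  apply: (eq_measurable_fun (fun t => f (affine s 0%R t))).
    move=> t; rewrite inE/= in_itv/= andbT => t0; apply: fE => //.
    by rewrite /affine addr0 exprMn sqr_sqrtr// ltW.
  apply/measurable_funTS; apply: measurableT_comp => //.
  exact: measurable_affine.
- move=> t _; rewrite mule_ge0 ?lee_fin ?expR_ge0// integral_ge0// => y _.
  by rewrite lee_fin mulr_ge0 ?expR_ge0 ?powR_ge0.
- by rewrite lee_fin normal_peak_ge0.
rewrite muleA -EFinM; congr (_%:E * _).
rewrite /normal_peak expr1n mul1r.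
have := pi_gt0 R; move: (pi : R) => c c0; set q := Num.sqrt (c *+ 2).
have q0 : (0 < q)%R by rewrite sqrtr_gt0 -(mulr_natl c 2) mulr_gt0.
have -> : (2 * k%:R / c = (s * 2 / q) ^+ 2)%R.
  rewrite expr_div_n exprMn sqr_sqrtr ?(ltW k0R)// sqr_sqrtr ?mulrn_wge0 ?(ltW c0)//.
  by rewrite -(mulr_natl c 2); field; rewrite gt_eqF.
by rewrite sqrtr_sqr ger0_norm// divr_ge0 ?mulr_ge0// ltW.
Qed.

(** Once the other coordinates are fixed, the first one is confined to two points. *)
Lemma gauss_cone_boundary p (k : R) (j : 'I_p) : (0 < k)%R ->
  gauss p.+1 [set y : p.+1.-tuple T |
    (k * tnth y (lift ord0 j) ^+ 2 = tnth y ord0 ^+ 2)%R] = 0.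
Proof.
move=> k0; rewrite gauss_consE2.
  apply: integral0_eq => t _.
  rewrite (_ : [set x | _] = [set (Num.sqrt (k * tnth t j ^+ 2))%R;
     (- Num.sqrt (k * tnth t j ^+ 2))%R]).
    apply: normal_null; first exact: measurableU.
    by apply: countable_lebesgue_measure0; exact/finite_set_countable/finite_set2.
  have c0 : (0 <= k * tnth t j ^+ 2)%R by rewrite mulr_ge0 ?sqr_ge0// ltW.
  apply/seteqP; split => x /=; rewrite tnthS tnth_tuple_cons0/=.
    move=> xE; have : (x ^+ 2 == Num.sqrt (k * tnth t j ^+ 2) ^+ 2)%R.
      by rewrite sqr_sqrtr// xE.
    by rewrite eqf_sqr => /orP[] /eqP ->; [left|right].
  by case=> ->; rewrite ?sqrrN sqr_sqrtr.
have m1 : measurable_fun setT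
    (fun y : p.+1.-tuple T => k * tnth y (lift ord0 j) ^+ 2 : T)%R.
  by apply: measurable_funM => //; apply: measurable_funX; exact: measurable_tnth.
have m2 : measurable_fun setT (fun y : p.+1.-tuple T => tnth y ord0 ^+ 2 : T)%R.
  by apply: measurable_funX; exact: measurable_tnth.
rewrite (_ : [set y | _] = [set y : p.+1.-tuple T |
    (k * tnth y (lift ord0 j) ^+ 2 <= tnth y ord0 ^+ 2)%R &&
    (tnth y ord0 ^+ 2 <= k * tnth y (lift ord0 j) ^+ 2)%R]).
  by apply: measurable_bool_set; apply: measurable_and; exact: measurable_fun_ler.
apply/seteqP; split => y /=; first by move=> ->; rewrite lexx.
by rewrite -eq_le => /eqP.
Qed.

End gauss_cone.

(** * Minors of a random orthogonal matrix *)

Section measurable_mx.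
Context {R : realType} d (U : measurableType d).
Local Notation T := (measurableTypeR R).

Definition measurable_mx p q (A : U -> 'M[R]_(p, q)) : Prop :=
  forall i j, measurable_fun setT (fun u => A u i j : T).

Lemma measurable_mx_cst p q (A : 'M[R]_(p, q)) : measurable_mx (fun=> A).
Proof. by move=> i j; exact: measurable_cst. Qed.

Lemma measurable_mulmx p q r (A : U -> 'M[R]_(p, q)) (B : U -> 'M[R]_(q, r)) :
  measurable_mx A -> measurable_mx B -> measurable_mx (fun u => A u *m B u).
Proof.
move=> mA mB i j; under eq_fun do rewrite mxE.
apply: measurable_sum => l; apply: measurable_funM; [exact: mA|exact: mB].
Qed.

Lemma measurable_mxsub p q p' q' (f : 'I_p' -> 'I_p) (g : 'I_q' -> 'I_q)
    (A : U -> 'M[R]_(p, q)) :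
  measurable_mx A -> measurable_mx (fun u => mxsub f g (A u)).
Proof. by move=> mA i j; under eq_fun do rewrite mxE; exact: mA. Qed.

Lemma measurable_det p (A : U -> 'M[R]_p) :
  measurable_mx A -> measurable_fun setT (fun u => \det (A u) : T).
Proof.
move=> mA; rewrite /determinant; apply: measurable_sum => s.
apply: measurable_funM => //; apply: measurable_prod => i _; exact: mA.
Qed.

Lemma measurable_adj p (A : U -> 'M[R]_p) :
  measurable_mx A -> measurable_mx (fun u => \adj (A u)).
Proof.
move=> mA i j; under eq_fun do rewrite mxE /cofactor.
apply: measurable_funM => //; apply: measurable_det => a b.
by under eq_fun do rewrite !mxE; exact: mA.
Qed.

End measurable_mx.

Section orthogonal_entries.
Context {R : realType} {n : nat}.
Local Notation T := (measurableTypeR R).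

Lemma continuous_orthogonal_entry i j :
  continuous (fun g : orthogonal_group R n => orthogonal_mx g i j).
Proof.
move=> g; apply: (@continuous_comp _ _ _ (@orthogonal_mx R n)
  (fun M : 'M[R]_n => M i j)); last exact: coord_continuous.
exact: initial_continuous.
Qed.

Lemma measurable_orthogonal_mx : measurable_mx (@orthogonal_mx R n).
Proof.
move=> i j; apply: (measurability _ (RGenOInfty.measurableE R)).
move=> /= _ [_ [a ->]] <-; rewrite setTI; apply: sub_sigma_algebra.
have /continuousP := @continuous_orthogonal_entry i j; apply.
exact: interval_open.
Qed.

End orthogonal_entries.

Section reflection.
Context {R : realType} {n : nat}.
Implicit Types (w x : 'cV[R]_n).

Lemma dotE w x : dot w x = (w^T *m x) 0 0.
Proof. by rewrite mxE; apply: eq_bigr => i _; rewrite mxE. Qed.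

Lemma dotC w x : dot w x = dot x w.
Proof. by apply: eq_bigr => i _; rewrite mulrC. Qed.

(* If w = 0 then the coefficient is 2 / 0 = 0, and the matrix is the identity *)
Definition reflection_mx w : 'M[R]_n := 1%:M - (2 / dot w w) *: (w *m w^T).

Lemma reflection_mxM w p (A : 'M[R]_(n, p)) :
  reflection_mx w *m A = A - (2 / dot w w) *: (w *m (w^T *m A)).
Proof. by rewrite mulmxBl mul1mx -scalemxAl mulmxA. Qed.

Lemma reflection_mxE w p (A : 'M[R]_(n, p)) i j :
  (reflection_mx w *m A) i j =
  A i j - 2 / dot w w * w i 0 * \sum_l w l 0 * A l j.
Proof.
rewrite reflection_mxM !mxE big_ord1 mulrA mxE; congr (_ - _ * _).
by apply: eq_bigr => l _; rewrite mxE.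
Qed.

Lemma trmx_reflection w : (reflection_mx w)^T = reflection_mx w.
Proof. by rewrite linearB /= trmx1 linearZ /= trmx_mul trmxK. Qed.

Lemma reflection_mxK w : reflection_mx w *m reflection_mx w = 1%:M.
Proof.
rewrite reflection_mxM {1}/reflection_mx.
have -> : w^T *m reflection_mx w = (1 - 2 / dot w w * dot w w) *: w^T.
  rewrite /reflection_mx mulmxBr mulmx1 -scalemxAr mulmxA [w^T *m w]mx11_scalar.
  by rewrite -dotE mul_scalar_mx scalerA scalerBl scale1r.
rewrite -scalemxAr scalerA -addrA -opprD -scalerDl.
suff -> : 2 / dot w w + 2 / dot w w * (1 - 2 / dot w w * dot w w) = 0.
  by rewrite scale0r subr0.
have [->|w0] := eqVneq (dot w w) 0; first by rewrite invr0 mulr0 mul0r addr0.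
by rewrite divfK//; lra.
Qed.

Lemma orthogonal_reflection w : orthogonal_set (reflection_mx w).
Proof. by rewrite /orthogonal_set /= trmx_reflection reflection_mxK. Qed.

Definition reflection w : orthogonal_group R n :=
  SigSub (mem_set (orthogonal_reflection w)).

Lemma orthogonal_mx_reflectionM w (g : orthogonal_group R n) :
  orthogonal_mx (orthogonal_mul (reflection w) g) =
  reflection_mx w *m orthogonal_mx g.
Proof. by []. Qed.

End reflection.

Section disjoint_events.
Context {R : realType} d (U : measurableType d) (P : probability U R).
Local Open Scope ereal_scope.

(** Infinitely many disjoint events cannot share a positive probability. *)
Lemma equiprobable_trivIset0 (F : nat -> set U) (x : \bar R) :
  (forall i, measurable (F i)) -> trivIset setT F -> (forall i, P (F i) = x) ->
  x = 0.
Proof.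
move=> mF tF PF; have x0 : 0 <= x by rewrite -(PF 0%N).
have xfin : x \is a fin_num by rewrite -(PF 0%N) fin_num_measure.
apply/eqP; rewrite eq_le x0 andbT -(fineK xfin) lee_fin.
set r := fine x.
have le1 N : (N%:R * r <= 1)%R.
  rewrite -lee_fin.
  have : P (\bigcup_n F n) <= 1 by apply: probability_le1; exact: bigcupT_measurable.
  rewrite measure_bigcup//; apply: le_trans.
  apply: le_trans (nneseries_lim_ge N _) => //.
  rewrite (eq_bigl xpredT) => [|i]; last by rewrite in_setT.
  rewrite (eq_bigr (fun=> r%:E)) => [|i _]; last by rewrite /r fineK//; exact: PF.
  by rewrite sumEFin sumr_const_nat subn0 mulr_natl.
rewrite leNgt; apply/negP => r0.
have := le1 (Num.truncn r^-1).+1; rewrite leNgt => /negP; apply.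
by rewrite -ltr_pdivrMr// div1r truncnS_gt.
Qed.

Lemma measurable_exists (I : finType) (A : I -> set U) :
  (forall i, measurable (A i)) -> measurable [set u | exists i, A i u].
Proof.
move=> mA; rewrite (_ : [set u | _] = ~` [set u | forall i, (~` A i) u]).
  by apply/measurableC/measurable_forall => i; exact: measurableC.
apply/seteqP; split => u /=; first by move=> [i Au] /(_ i).
by move=> /existsNP[i]; rewrite notK; exists i.
Qed.

Lemma exists_null (I : finType) (A : I -> set U) :
  (forall i, measurable (A i)) -> (forall i, P (A i) = 0) ->
  P [set u | exists i, A i u] = 0.
Proof.
move=> mA A0; apply: measure_negligible; first exact: measurable_exists.
rewrite (_ : [set u | _] = [set u | exists2 i, i \in enum I & A i u]); last first.
  by apply/seteqP; split => u /= [i]; exists i; rewrite // mem_enum.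
elim: (enum I) => [|i s IH].
  rewrite (_ : [set u | _] = set0); first exact: negligible_set0.
  by apply/seteqP; split => u // -[].
rewrite (_ : [set u | _] = A i `|` [set u | exists2 i, i \in s & A i u]).
  by apply: negligibleU => //; apply/negligibleP; [exact: mA|exact: A0].
apply/seteqP; split => u /=.
  by move=> [j]; rewrite inE => /predU1P[->|js] Au; [left|right; exists j].
by case=> [Au|[j js Au]]; [exists i|exists j]; rewrite // inE ?eqxx ?js ?orbT.
Qed.

End disjoint_events.

Section minors.
Context {R : realType} {n k : nat} (le_kn : (k <= n)%N).
Local Notation T := (measurableTypeR R).
Local Notation cols := (widen_ord le_kn).
Implicit Types (f : 'I_k -> 'I_n) (g : orthogonal_group R n).

Definition minor f (A : 'M[R]_n) : R := \det (mxsub f cols A).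

Lemma measurable_minor_mul f (h : 'M[R]_n) :
  measurable_fun setT (fun g => minor f (h *m orthogonal_mx g) : T).
Proof.
apply: measurable_det; apply: measurable_mxsub; apply: measurable_mulmx.
  exact: measurable_mx_cst.
exact: measurable_orthogonal_mx.
Qed.

Lemma measurable_minor f :
  measurable_fun setT (fun g => minor f (orthogonal_mx g) : T).
Proof.
by apply: measurable_det; apply: measurable_mxsub; exact: measurable_orthogonal_mx.
Qed.

Lemma minor_tperm_codom f (A : 'M[R]_n) i0 i1 : injective f ->
  minor (tperm (f i0) (f i1) \o f) A = 0 <-> minor f A = 0.
Proof.
move=> finj; rewrite /minor.
have -> : mxsub (tperm (f i0) (f i1) \o f) cols A =
    perm_mx (tperm i0 i1) *m mxsub f cols A.
  by rewrite -row_permE; apply/matrixP => i j; rewrite !mxE /= inj_tperm.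
rewrite det_mulmx det_perm; split => [/eqP|->]; last by rewrite mulr0.
by rewrite mulf_eq0 signr_eq0 /= => /eqP.
Qed.

Definition plane_vec (a j : 'I_n) (t : R) : 'cV[R]_n :=
  \col_i ((i == a)%:R + t * (i == j)%:R).

Lemma plane_vec_dot (a j : 'I_n) t p (A : 'M[R]_(n, p)) (l : 'I_p) :
  \sum_i plane_vec a j t i 0 * A i l = A a l + t * A j l.
Proof.
under eq_bigr do rewrite mxE mulrDl; rewrite big_split /=.
rewrite (bigD1 a)//= eqxx mul1r big1 ?addr0; last first.
  by move=> i /negPf ->; rewrite mul0r.
rewrite (bigD1 j)//= eqxx mulr1 big1 ?addr0//.
by move=> i /negPf ->; rewrite mulr0 mul0r.
Qed.

Lemma minor_plane_reflection f (A : 'M[R]_n) i0 j t : injective f ->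
  (forall i, f i != j) ->
  (1 + t ^+ 2) * minor f (reflection_mx (plane_vec (f i0) j t) *m A) =
  (t ^+ 2 - 1) * minor f A - 2 * t * minor (tperm (f i0) j \o f) A.
Proof.
move=> finj fj; set w := plane_vec _ _ _.
have t0 : 1 + t ^+ 2 != 0 by rewrite gt_eqF// ltr_pwDl// sqr_ge0.
have aj : f i0 != j by exact: fj.
have ww : dot w w = 1 + t ^+ 2.
  rewrite [dot w w](_ : _ = \sum_i plane_vec (f i0) j t i 0 * w i 0)//.
  rewrite plane_vec_dot !mxE !eqxx (negPf aj) eq_sym (negPf aj) mulr0 mulr1.
  by rewrite addr0 add0r expr2.
have HE i l : mxsub f cols (reflection_mx w *m A) i l =
    A (f i) (cols l) - 2 / (1 + t ^+ 2) * w (f i) 0 *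
    (A (f i0) (cols l) + t * A j (cols l)).
  by rewrite mxE reflection_mxE plane_vec_dot ww.
have w_f i : i != i0 -> w (f i) 0 = 0.
  by move=> ii0; rewrite mxE (inj_eq finj) (negPf ii0) (negPf (fj _)) mulr0 addr0.
have -> : minor f (reflection_mx w *m A) =
   (t ^+ 2 - 1) / (1 + t ^+ 2) * minor f A +
   (- (2 * t) / (1 + t ^+ 2)) * minor (tperm (f i0) j \o f) A.
  rewrite /minor; apply: (determinant_multilinear (i0 := i0)).
  - apply/rowP => l; rewrite [LHS]mxE HE !mxE /= tpermL eqxx (negPf aj) /=.
    rewrite mulr0 addr0 mulr1; move: (A _ _) (A _ _) => a1 a2.
    by field.
  - apply/matrixP => i l; rewrite [LHS]mxE [RHS]mxE HE w_f 1?eq_sym ?neq_lift//.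
    by rewrite mxE mulr0 mul0r subr0.
  - apply/matrixP => i l; rewrite [LHS]mxE [RHS]mxE HE w_f 1?eq_sym ?neq_lift//.
    rewrite mxE mulr0 mul0r subr0 /= tpermD//; last by rewrite eq_sym.
    by rewrite (inj_eq finj) neq_lift.
by field.
Qed.

Variables (mu : probability (orthogonal_group R n) R) (haar_mu : is_haar mu).

(** Reflecting in the plane of two basis vectors turns the minor into a combination of
    the minor and the exchanged minor, with coefficients that change with the
    reflection. When the exchanged minor is nonzero, at most one reflection of the
    family makes the combination vanish: the corresponding events are disjoint and, by
    invariance, equiprobable. *)
Lemma minor_exchange_null f i0 j : injective f ->
  mu [set g | minor f (orthogonal_mx g) = 0 /\
    minor (tperm (f i0) j \o f) (orthogonal_mx g) != 0] = 0%E.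
Proof.
move=> finj; have [/existsP[i1 /eqP <-]|/existsPn fj] := boolP [exists i1, f i1 == j].
  rewrite (_ : [set g | _] = set0) ?measure0//; apply/seteqP; split => // g /= [Dg].
  by have [_ ->] := minor_tperm_codom (orthogonal_mx g) i0 i1 finj; rewrite ?eqxx.
set f' := _ \o f.
(* t > 1 makes t^2 - 1 positive and (t^2 - 1) / t injective in t *)
pose t (i : nat) : R := i.+2%:R.
pose h i := reflection (plane_vec (f i0) j (t i)).
pose D f : set (orthogonal_group R n) := [set g | minor f (orthogonal_mx g) = 0].
have mD f0 : measurable (D f0).
  apply: (measurable_preimage (measurable_minor f0) (measurable_set1 0)).
pose F i := orthogonal_mul (h i) @^-1` D f `&` ~` D f'.
have t2 i : t i ^+ 2 - 1 > 0.
  by rewrite subr_gt0 exprn_egt1// ltr1n.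
have Dh i g : (orthogonal_mul (h i) @^-1` D f) g <->
    (t i ^+ 2 - 1) * minor f (orthogonal_mx g) = 2 * t i * minor f' (orthogonal_mx g).
  have := minor_plane_reflection (orthogonal_mx g) i0 (t i) finj fj.
  rewrite -/f' /D /= orthogonal_mx_reflectionM => E; split => H.
    by move: E; rewrite H mulr0 => /esym/eqP; rewrite subr_eq0 => /eqP.
  move: E; rewrite H subrr => /eqP; rewrite mulf_eq0 => /orP[|/eqP//].
  by rewrite gt_eqF// ltr_pwDl// sqr_ge0.
have mDh i : measurable (orthogonal_mul (h i) @^-1` D f).
  exact: (measurable_preimage (measurable_minor_mul f (reflection_mx _))
    (measurable_set1 0)).
have muF i : mu (F i) = mu (D f `&` ~` D f').
  rewrite -!setDE !measureD// ?ltey_eq ?fin_num_measure//.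
  rewrite [X in (X - _)%E](_ : _ = mu (D f)); last exact: haar_mu.
  congr (_ - mu _)%E; apply/seteqP; split => g [/= fg f'g]; split => //.
    move: fg => /Dh; rewrite f'g mulr0 => /eqP; rewrite mulf_eq0 => /orP[|/eqP//].
    by rewrite gt_eqF.
  by apply/Dh; rewrite f'g fg !mulr0.
rewrite (_ : [set g | _] = D f `&` ~` D f'); last first.
  by apply/seteqP; split => g /= [Dg D'g]; split => //; apply/eqP.
apply: (@equiprobable_trivIset0 _ _ _ mu F) => //.
- by move=> i; apply: measurableI => //; exact: measurableC.
- apply/trivIsetP => i l _ _ il; apply/seteqP; split => // g /= [[/Dh ti /eqP d'0] [/Dh tl _]].
  move: ti tl d'0; set d := minor f _; set d' := minor f' _ => ti tl d'0.
  have t0 q : 0 < t q by rewrite ltr0n.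
  have d0 : d != 0.
    apply: contra_neq d'0 => d0; move: ti; rewrite d0 mulr0 => /esym/eqP.
    by rewrite mulf_eq0 gt_eqF ?mulr_gt0// => /eqP.
  have /eqP : d * ((t i - t l) * (t i * t l + 1)) = 0.
    rewrite (_ : d * _ = (t i ^+ 2 - 1) * d * t l - (t l ^+ 2 - 1) * d * t i); last by ring.
    by rewrite ti tl; ring.
  rewrite !mulf_eq0 (negPf d0) /= [X in _ || X]gt_eqF ?orbF; last first.
    by rewrite ltr_wpDl// mulr_ge0// ltW.
  by rewrite subr_eq0 /t eqr_nat !eqSS (negPf il).
Qed.

(** Almost surely the vanishing of one minor propagates to all the others, one exchanged
    row after the other; and an invertible matrix has a nonzero minor. *)
Lemma minor_null f : injective f -> mu [set g | minor f (orthogonal_mx g) = 0] = 0%E.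
Proof.
move=> finj.
pose Bad (x : {ffun 'I_k -> 'I_n} * ('I_k * 'I_n)) : set (orthogonal_group R n) :=
  if injectiveb x.1 then [set g | minor x.1 (orthogonal_mx g) = 0 /\
    minor (tperm (x.1 x.2.1) x.2.2 \o x.1) (orthogonal_mx g) != 0] else set0.
have m0 f0 : measurable [set g | minor f0 (orthogonal_mx g) = 0].
  exact: (measurable_preimage (measurable_minor f0) (measurable_set1 0)).
have mBad x : measurable (Bad x).
  rewrite /Bad; case: ifPn => _ //.
  set f' := _ \o _.
  rewrite (_ : [set g | _] = [set g | minor x.1 (orthogonal_mx g) = 0] `&`
     ~` [set g | minor f' (orthogonal_mx g) = 0]).
    by apply: measurableI => //; exact: measurableC.
  by apply/seteqP; split => g /= [Dg D'g]; split => //; apply/eqP.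
have Bad0 x : mu (Bad x) = 0%E.
  rewrite /Bad; case: ifPn => [/injectiveP xinj|_]; last exact: measure0.
  exact: minor_exchange_null.
apply: (@subset_measure0 _ _ _ _ _ [set g | exists x, Bad x g]).
- exact: m0.
- exact: measurable_exists.
- move=> g /= fg0; apply: contrapT => gBad.
  pose A := colsub cols (orthogonal_mx g).
  have fullA : row_full A.
    apply/row_fullP; exists A^T.
    have /mulmx1C gg := orthogonal_mxP g.
    rewrite /A; apply/matrixP => i j; move/matrixP/(_ (cols i) (cols j)): gg.
    rewrite !mxE => gg; rewrite -[RHS]gg.
    by apply: eq_bigr => l _; rewrite !mxE.
  pose f1 := fullrankfun fullA.
  have f1inj : injective f1 by exact: fullrankfun_inj.
  have f1g0 : minor f1 (orthogonal_mx g) != 0.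
    have := fullrowsub_unit fullA; rewrite unitmxE unitfE => d0.
    by rewrite /minor mxsubrc.
  (* exchanging f i0 and f1 i0 keeps the minor zero and brings f closer to f1 *)
  have [N] := ubnP #|[pred i | f i != f1 i]|.
  elim: N f finj fg0 => // N IH f finj fg0 cardN.
  have [/existsP[i0 fi0]|/existsPn ff1] := boolP [exists i, f i != f1 i]; last first.
    have fE : f = f1.
      by apply/funext => i; have := ff1 i; rewrite negbK => /eqP.
    by move: f1g0; rewrite -fE fg0 eqxx.
  pose f2 := tperm (f i0) (f1 i0) \o f.
  have f2inj : injective f2 by move=> i j /perm_inj /finj.
  apply: (IH f2 f2inj).
    apply/eqP; apply: contra_notT gBad => f2g; exists ([ffun i => f i], (i0, f1 i0)).
    have Ef : ([ffun i => f i] : 'I_k -> 'I_n) = f by apply/funext => i; rewrite ffunE.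
    rewrite /Bad /= Ef; case: ifPn => [_//|/injectiveP []//].
  move: cardN; rewrite ltnS; apply: leq_trans; apply: proper_card; apply/properP; split.
    apply/fintype.subsetP => i; rewrite !inE /f2 /=; apply: contra => /eqP fi.
    have ii0 : i != i0 by apply: contraNneq fi0 => <-; rewrite fi.
    have h1 : f i0 != f i by rewrite (inj_eq finj) eq_sym.
    have h2 : f1 i0 != f i by rewrite fi (inj_eq f1inj) eq_sym.
    by rewrite tpermD// fi.
  by exists i0; rewrite !inE /f2 /= ?tpermL ?eqxx.
- exact: exists_null.
Qed.

End minors.

(** * The line where the section meets a slice *)

Section section_vector.
Context {R : realType} {n k p : nat} (le_kn : (k <= n)%N).
Local Notation T := (measurableTypeR R).
Local Notation cols := (widen_ord le_kn).
Local Notation minor := (@minor R n k le_kn).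
Variables (f : 'I_k -> 'I_n) (fc : 'I_p -> 'I_n) (eps : 'cV[R]_k).
Hypotheses (finj : injective f) (fcinj : injective fc)
  (ffc : forall a b, f a != fc b)
  (cover : forall i, (exists a, i = f a) \/ (exists b, i = fc b)).
Hypothesis eps2 : forall a, eps a 0 ^+ 2 = 1.
Hypothesis k_gt0 : (0 < k)%N.
Implicit Types (A : 'M[R]_n) (g : orthogonal_group R n).

Lemma tnth_beheadS m (y : m.+1.-tuple T) b :
  tnth [tuple of behead y] b = tnth y (lift ord0 b).
Proof.
rewrite tnth_behead; congr tnth; apply/val_inj; rewrite /= inordK//.
by rewrite ltnS ltn_ord.
Qed.

(** By Cramer's rule, the minor times the point of the section whose coordinates on the
    rows f are eps. Being polynomial in the matrix it is measurable, and it makes sense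
    when the minor vanishes. *)
Definition section_vec A : 'cV[R]_n :=
  colsub cols A *m (\adj (mxsub f cols A) *m eps).

Lemma section_vec_f A a : section_vec A (f a) 0 = minor f A * eps a 0.
Proof.
transitivity ((mxsub f cols A *m (\adj (mxsub f cols A) *m eps)) a 0).
  by rewrite !mxE; apply: eq_bigr => i _; rewrite !mxE.
by rewrite mulmxA mul_mx_adj mul_scalar_mx mxE.
Qed.

Lemma measurable_section_vec_mul (h : 'M[R]_n) :
  measurable_mx (fun g => section_vec (h *m orthogonal_mx g)).
Proof.
have mh : measurable_mx (fun g => h *m orthogonal_mx g).
  by apply: measurable_mulmx; [exact: measurable_mx_cst|exact: measurable_orthogonal_mx].
apply: measurable_mulmx; first exact: measurable_mxsub.
apply: measurable_mulmx; last exact: measurable_mx_cst.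
by apply: measurable_adj; exact: measurable_mxsub.
Qed.

Lemma measurable_section_vec :
  measurable_mx (fun g => section_vec (orthogonal_mx g)).
Proof.
by have := measurable_section_vec_mul 1%:M; under eq_fun do rewrite mul1mx.
Qed.

Lemma sum_split (F : 'I_n -> R) : \sum_i F i = \sum_a F (f a) + \sum_b F (fc b).
Proof.
have pick q (h : 'I_q -> 'I_n) : \sum_a F (h a) = \sum_i \sum_a (i == h a)%:R * F i.
  rewrite exchange_big; apply: eq_bigr => a _ /=.
  rewrite (bigD1 (h a))//= eqxx mul1r big1 ?addr0// => i /negPf ->.
  by rewrite mul0r.
rewrite (pick _ f) (pick _ fc) -big_split; apply: eq_bigr => i _ /=; rewrite -!mulr_suml -mulrDl.
suff -> : \sum_a (i == f a)%:R + \sum_b (i == fc b)%:R = 1 :> R by rewrite mul1r.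
have [[a ->]|[b ->]] := cover i.
  rewrite [X in _ + X]big1 ?addr0 => [|b _]; last by rewrite (negPf (ffc _ _)).
  rewrite (bigD1 a)//= eqxx big1 ?addr0// => a' a'a.
  by rewrite (inj_eq finj) eq_sym (negPf a'a).
rewrite big1 ?add0r => [|a _]; last by rewrite eq_sym (negPf (ffc _ _)).
rewrite (bigD1 b)//= eqxx big1 ?addr0// => b' b'b.
by rewrite (inj_eq fcinj) eq_sym (negPf b'b).
Qed.

(** The slice is the space of the vectors that are proportional to eps on the rows f. It
    contains the section vector; slice_coord and slice_vec are its coordinates in the
    orthonormal basis made of eps / sqrt k and the remaining basis vectors. *)
Definition slice_coord (x : 'cV[R]_n) (c : R) : p.+1.-tuple T :=
  tuple_cons (Num.sqrt k%:R * c, [tuple x (fc b) 0 | b < p]).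

Definition slice_vec (y : p.+1.-tuple T) : 'cV[R]_n :=
  \col_i (\sum_a (i == f a)%:R * (tnth y ord0 / Num.sqrt k%:R * eps a 0) +
          \sum_b (i == fc b)%:R * tnth y (lift ord0 b)).

Lemma slice_vec_f y a : slice_vec y (f a) 0 = tnth y ord0 / Num.sqrt k%:R * eps a 0.
Proof.
rewrite mxE (bigD1 a)//= eqxx mul1r big1 ?addr0 => [|i ia]; last first.
  by rewrite (inj_eq finj) eq_sym (negPf ia) mul0r.
by rewrite big1 ?addr0// => b _; rewrite (negPf (ffc _ _)) mul0r.
Qed.

Lemma slice_vec_fc y b : slice_vec y (fc b) 0 = tnth y (lift ord0 b).
Proof.
rewrite mxE big1 ?add0r => [|a _]; last first.
  by rewrite eq_sym (negPf (ffc _ _)) mul0r.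
rewrite (bigD1 b)//= eqxx mul1r big1 ?addr0// => i ib.
by rewrite (inj_eq fcinj) eq_sym (negPf ib) mul0r.
Qed.

Definition section_coord g : p.+1.-tuple T :=
  slice_coord (section_vec (orthogonal_mx g)) (minor f (orthogonal_mx g)).

Lemma sqrtk_neq0 : Num.sqrt k%:R != 0 :> R.
Proof. by rewrite gt_eqF// sqrtr_gt0 ltr0n. Qed.

Lemma sqrtk2 : Num.sqrt k%:R * Num.sqrt k%:R = k%:R :> R.
Proof. by rewrite -expr2 sqr_sqrtr// ler0n. Qed.

Lemma sum_eps (c : R) : \sum_a (c * eps a 0 * eps a 0) = c * k%:R.
Proof.
under eq_bigr do rewrite -mulrA -expr2 eps2 mulr1.
by rewrite sumr_const card_ord mulr_natr.
Qed.

Lemma tdot_slice_coord (x : 'cV[R]_n) c y : (forall a, x (f a) 0 = c * eps a 0) ->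
  tdot (slice_coord x c) y = dot x (slice_vec y).
Proof.
move=> xf; rewrite /dot sum_split {1}(tuple_consE y) tdot_cons; congr (_ + _).
  under eq_bigr do rewrite xf slice_vec_f.
  rewrite (eq_bigr (fun a => (c * (tnth y ord0 / Num.sqrt k%:R)) * eps a 0 * eps a 0)).
    rewrite sum_eps -[X in _ = _ * X]sqrtk2; move: (Num.sqrt _) sqrtk_neq0 (tnth y _) => s s0 y0.
    by field.
  by move=> a _; ring.
apply: eq_bigr => b _; rewrite slice_vec_fc tnth_mktuple; congr (_ * _).
by rewrite tnth_beheadS.
Qed.

Lemma tdot_slice_coordxx (x : 'cV[R]_n) c : (forall a, x (f a) 0 = c * eps a 0) ->
  tdot (slice_coord x c) (slice_coord x c) = dot x x.
Proof.
move=> xf; rewrite tdot_slice_coord//; congr dot.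
apply/matrixP => i j; rewrite ord1; have [[a ->]|[b ->]] := cover i.
  by rewrite slice_vec_f tnth_tuple_cons0/= xf [_ * c]mulrC mulfK ?sqrtk_neq0.
by rewrite slice_vec_fc tnthS tnth_mktuple.
Qed.

Lemma tdot_slice_vec y : tdot y y = dot (slice_vec y) (slice_vec y).
Proof.
have <- := @tdot_slice_coord (slice_vec y) (tnth y ord0 / Num.sqrt k%:R) y.
  congr tdot; rewrite {1}(tuple_consE y) /slice_coord mulrC divfK ?sqrtk_neq0//.
  congr (tuple_cons (_, _)); apply: eq_from_tnth => b.
  by rewrite tnth_mktuple slice_vec_fc tnth_beheadS.
by move=> a; rewrite slice_vec_f.
Qed.

(** The same condition as tclose, for columns: slice_vec is an isometry from tuples to
    columns. *)
Definition dclose (r : R) (u v : 'cV[R]_n) : bool :=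
  [&& 0 < dot u u, 0 < dot v v & (1 - r) * (dot u u * dot v v) <= dot u v ^+ 2].

Lemma tclose_section_coord r g y : tclose r (section_coord g) y =
  dclose r (section_vec (orthogonal_mx g)) (slice_vec y).
Proof.
have Uf := section_vec_f (orthogonal_mx g).
by rewrite /tclose tdot_slice_coordxx// tdot_slice_coord// tdot_slice_vec.
Qed.

Lemma dotZl c (u v : 'cV[R]_n) : dot (c *: u) v = c * dot u v.
Proof. by rewrite /dot mulr_sumr; apply: eq_bigr => i _; rewrite mxE mulrA. Qed.

Lemma dotZr c (u v : 'cV[R]_n) : dot u (c *: v) = c * dot u v.
Proof. by rewrite dotC dotZl dotC. Qed.

Lemma dotBl (u v x : 'cV[R]_n) : dot (u - v) x = dot u x - dot v x.
Proof. by rewrite /dot -sumrB; apply: eq_bigr => i _; rewrite !mxE mulrBl. Qed.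

Lemma dotxx_eq0 (u : 'cV[R]_n) : dot u u = 0 -> u = 0.
Proof.
move=> /eqP; rewrite psumr_eq0 => [/allP u0|i _]; last by rewrite -expr2 sqr_ge0.
apply/matrixP => i j; rewrite ord1 [RHS]mxE; apply/eqP.
by rewrite -sqrf_eq0 expr2; apply: (u0 i); rewrite mem_index_enum.
Qed.

Lemma dot_reflectionl (w u v : 'cV[R]_n) :
  dot (reflection_mx w *m u) v = dot u (reflection_mx w *m v).
Proof. by rewrite !dotE trmx_mul trmx_reflection mulmxA. Qed.

Lemma dot_reflection (w u v : 'cV[R]_n) :
  dot (reflection_mx w *m u) (reflection_mx w *m v) = dot u v.
Proof. by rewrite dot_reflectionl mulmxA reflection_mxK mul1mx. Qed.

Lemma reflection_swap (v v' : 'cV[R]_n) : dot v v = dot v' v' ->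
  reflection_mx (v - v') *m v = v'.
Proof.
move=> vv'; set w := v - v'.
have ww : dot w w = 2 * dot w v.
  rewrite {1}/w dotBl [dot v w]dotC [dot v' w]dotC !dotBl (dotC v' v) -vv'; ring.
have [w0|w0] := eqVneq (dot w w) 0.
  have /eqP := dotxx_eq0 w0; rewrite subr_eq0 => /eqP vE.
  by rewrite reflection_mxM w0 invr0 mulr0 scale0r subr0.
apply/matrixP => i j; rewrite ord1 reflection_mxE.
have -> : \sum_l w l 0 * v l 0 = dot w w / 2 by rewrite ww mulrC mulKf ?pnatr_eq0.
rewrite mulrAC (_ : 2 / _ * (_ / 2) = 1); last by field.
by rewrite mul1r !mxE opprB addrC subrK.
Qed.

Lemma dcloseZl r c u v : c != 0 -> dclose r (c *: u) v = dclose r u v.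
Proof.
move=> c0; have c2 : 0 < c ^+ 2 by rewrite exprn_even_gt0.
rewrite /dclose !dotZl dotZr mulrA -expr2 pmulr_rgt0// exprMn.
by rewrite -mulrA (mulrCA (1 - r)) ler_pM2l.
Qed.

Lemma dcloseZr r c u v : c != 0 -> dclose r u (c *: v) = dclose r u v.
Proof.
move=> c0; have c2 : 0 < c ^+ 2 by rewrite exprn_even_gt0.
rewrite /dclose !dotZr dotZl mulrA -expr2 pmulr_rgt0// exprMn.
by rewrite (mulrCA (dot u u)) (mulrCA (1 - r)) ler_pM2l.
Qed.

Lemma measurable_section_coord_mul (h : 'M[R]_n) : measurable_fun setT
  (fun g => slice_coord (section_vec (h *m orthogonal_mx g))
    (minor f (h *m orthogonal_mx g))).
Proof.
apply/measurable_fun_tnthP => i; have [b ->|->] := unliftP ord0 i.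
  rewrite [X in measurable_fun _ X](_ : _ =
    (fun g => section_vec (h *m orthogonal_mx g) (fc b) 0 : T)).
    exact: measurable_section_vec_mul.
  by apply/funext => g; rewrite /= tnthS tnth_mktuple.
rewrite [X in measurable_fun _ X](_ : _ =
  (fun g => Num.sqrt k%:R * minor f (h *m orthogonal_mx g) : T)).
  by apply: measurable_funM => //; exact: measurable_minor_mul.
by apply/funext => g.
Qed.

Lemma measurable_section_coord : measurable_fun setT section_coord.
Proof.
rewrite [X in measurable_fun _ X](_ : _ = (fun g : orthogonal_group R n =>
  slice_coord (section_vec (1%:M *m orthogonal_mx g))
    (minor f (1%:M *m orthogonal_mx g)))); first exact: measurable_section_coord_mul.
by apply/funext => g; rewrite mul1mx.
Qed.

Lemma section_vec_neq0 g : minor f (orthogonal_mx g) != 0 ->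
  0 < dot (section_vec (orthogonal_mx g)) (section_vec (orthogonal_mx g)).
Proof.
move=> D0; have xf := section_vec_f (orthogonal_mx g).
rewrite -(tdot_slice_coordxx xf).
apply: lt_le_trans (sqr_tnth_le _ ord0); rewrite tnth_tuple_cons0/=.
by rewrite exprn_even_gt0//= mulf_neq0// sqrtk_neq0.
Qed.

(** The normal vector w belongs to the slice, so that the reflection preserves the slice
    and sends its intersection with the section to its intersection with the reflected
    section; both intersections are lines spanned by section vectors when the minors do
    not vanish. *)
Lemma section_vec_reflection (w : 'cV[R]_n) cw A :
  (forall a, w (f a) 0 = cw * eps a 0) ->
  exists c, minor f (reflection_mx w *m A) *: (reflection_mx w *m section_vec A) =
    c *: section_vec (reflection_mx w *m A).
Proof.
move=> wf; set H := reflection_mx w.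
pose z := \adj (mxsub f cols A) *m eps.
have HU : H *m section_vec A = colsub cols (H *m A) *m z.
  by rewrite /section_vec mulmxA mulmx_colsub.
pose c := minor f A - 2 / dot w w * cw * \sum_l w l 0 * section_vec A l 0.
have fz : mxsub f cols (H *m A) *m z = c *: eps.
  apply/matrixP => a b; rewrite ord1.
  transitivity ((H *m section_vec A) (f a) 0).
    by rewrite HU !mxE; apply: eq_bigr => i _; rewrite !mxE.
  by rewrite reflection_mxE section_vec_f wf [RHS]mxE /c; ring.
exists c; rewrite HU scalemxAr.
have -> : minor f (H *m A) *: z = \adj (mxsub f cols (H *m A)) *m (c *: eps).
  by rewrite -fz mulmxA mul_adj_mx mul_scalar_mx.
by rewrite -scalemxAr -scalemxAr.
Qed.

Variables (mu : probability (orthogonal_group R n) R) (haar_mu : is_haar mu).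

Let mu_minor_mul (h : orthogonal_group R n) :
  mu [set g | minor f (orthogonal_mx (orthogonal_mul h g)) != 0] = 1%E.
Proof.
have m0 : measurable [set g : orthogonal_group R n | minor f (orthogonal_mx g) = 0].
  exact: (measurable_preimage (measurable_minor _ _) (measurable_set1 0)).
rewrite (_ : [set g | _] =
    orthogonal_mul h @^-1` (~` [set g | minor f (orthogonal_mx g) = 0])).
  transitivity (mu (~` [set g | minor f (orthogonal_mx g) = 0])).
    by apply: haar_mu; exact: measurableC.
  by rewrite probability_setC// [X in (_ - X)%E](minor_null le_kn haar_mu finj) sube0.
by apply/seteqP; split => g /= /eqP.
Qed.

Let mu_minor : mu [set g | minor f (orthogonal_mx g) != 0] = 1%E.
Proof.
have m0 : measurable [set g : orthogonal_group R n | minor f (orthogonal_mx g) = 0].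
  exact: (measurable_preimage (measurable_minor _ _) (measurable_set1 0)).
rewrite (_ : [set g | _] = ~` [set g | minor f (orthogonal_mx g) = 0]).
  by rewrite probability_setC// [X in (_ - X)%E](minor_null le_kn haar_mu finj) sube0.
by apply/seteqP; split => g /= /eqP.
Qed.

(** Two vectors of the slice with the same norm are exchanged by a reflection along
    their difference, which is again in the slice; left invariance absorbs this
    reflection. *)
Lemma isotropic_section_coord : isotropic mu section_coord.
Proof.
have mZ := measurable_section_coord.
have mN (h : 'M[R]_n) : measurable [set g | minor f (h *m orthogonal_mx g) != 0].
  rewrite (_ : [set g | _] = ~` [set g | minor f (h *m orthogonal_mx g) = 0]).
    apply/measurableC.
    exact: (measurable_preimage (measurable_minor_mul _ _ _) (measurable_set1 0)).
  by apply/seteqP; split => g /= /eqP.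
have mN1 : measurable [set g : orthogonal_group R n | minor f (orthogonal_mx g) != 0].
  by have := mN 1%:M; under eq_set do rewrite mul1mx.
split => //.
  apply/eqP; rewrite eq_le probability_le1 ?andTb; last exact: measurable_tdot_gt0.
  rewrite -mu_minor; apply: le_measure; rewrite ?inE.
  - exact: mN1.
  - exact: measurable_tdot_gt0.
  move=> g /= D0; rewrite tdot_slice_coordxx; last exact: section_vec_f.
  exact: section_vec_neq0.
move=> r y y' y0 y'0.
pose c := Num.sqrt (tdot y y / tdot y' y').
have c0 : c != 0 by rewrite gt_eqF// sqrtr_gt0 divr_gt0.
pose v := slice_vec y; pose v' := c *: slice_vec y'.
have vv' : dot v v = dot v' v'.
  rewrite /v' dotZl dotZr -!tdot_slice_vec mulrA -expr2 sqr_sqrtr.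
    by rewrite divfK// gt_eqF.
  by rewrite ltW// divr_gt0.
pose w := v - v'.
pose cw := (tnth y ord0 - c * tnth y' ord0) / Num.sqrt k%:R.
have wf a : w (f a) 0 = cw * eps a 0.
  rewrite /w [LHS]mxE [X in _ + X]mxE [X in - X]mxE !slice_vec_f /cw; ring.
pose h := reflection w.
have close g : minor f (orthogonal_mx g) != 0 ->
    minor f (orthogonal_mx (orthogonal_mul h g)) != 0 ->
    tclose r (section_coord g) y' = tclose r (section_coord (orthogonal_mul h g)) y.
  move=> D0; rewrite !tclose_section_coord -/v -(dcloseZr _ _ _ c0) -/v'.
  rewrite /h orthogonal_mx_reflectionM => D'0.
  have [c' E] := section_vec_reflection (orthogonal_mx g) wf.
  have c'0 : c' != 0.
    apply: contra_neq D'0 => c'0; apply/eqP; move: E; rewrite c'0 scale0r => /eqP.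
    rewrite scaler_eq0 => /orP[//|/eqP HU0].
    have := section_vec_neq0 D0.
    by rewrite -(dot_reflection w) HU0 /dot big1 ?ltxx// => i _; rewrite mxE mul0r.
  rewrite -[RHS](dcloseZl _ _ _ c'0) -E dcloseZl//.
  by rewrite /dclose !dot_reflection dot_reflectionl reflection_swap// -vv'.
have mA : measurable [set g | tclose r (section_coord g) y].
  by apply: measurable_tclose => //; exact: measurable_cst.
have mB : measurable [set g | tclose r (section_coord g) y'].
  by apply: measurable_tclose => //; exact: measurable_cst.
rewrite -(haar_mu h mA); set A' := _ @^-1` _.
have mA' : measurable A'.
  apply: (@measurable_tclose _ _ _ _ _ (fun g => section_coord (orthogonal_mul h g)) (cst y)).
    exact: measurable_section_coord_mul.
  exact: measurable_cst.
pose N2 := [set g | minor f (orthogonal_mx (orthogonal_mul h g)) != 0].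
have mN2 : measurable N2 by exact: mN.
rewrite -(probability_setI1 mA' mN1 mu_minor) -(probability_setI1 mB mN1 mu_minor).
rewrite -(probability_setI1 (measurableI _ _ mA' mN1) mN2 (mu_minor_mul h)).
rewrite -(probability_setI1 (measurableI _ _ mB mN1) mN2 (mu_minor_mul h)).
congr (mu _); apply/seteqP; split => g /= [[cl N1] N2g]; split => //; split => //.
  by rewrite close.
by rewrite /A' /= -close.
Qed.

End section_vector.

Section section_cone.
Context {R : realType}.
Local Notation T := (measurableTypeR R).

(** Two inequalities between isotropic laws, in opposite directions. *)
Lemma isotropic_qcone_gauss d (U : measurableType d) (P : probability U R) m
    (Z : U -> m.+1.-tuple T) (I : finType) (a : I -> 'I_m.+1 -> R) :
  isotropic P Z -> P (Z @^-1` qcone a 0) = gauss m.+1 (qcone a 0).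
Proof.
move=> isoZ; have isoG := @isotropic_gauss R m.
pose e : m.+1.-tuple T := tuple_cons ((1 : T), [tuple of nseq m (0 : T)]).
have e0 : 0 < tdot e e.
  by apply: lt_le_trans (sqr_tnth_le _ ord0); rewrite tnth_tuple_cons0 expr1n.
apply/eqP; rewrite eq_le; apply/andP; split.
  apply: (isotropic_qcone_le a isoZ isoG e0) => r r0; right.
  exact: gauss_tclose_gt0.
apply: (isotropic_qcone_le a isoG isoZ e0) => r r0; left.
exact: gauss_tclose_gt0.
Qed.

(** Coefficients of the form k y_j^2 - y_0^2, where y_0 is the first coordinate. *)
Definition cone_coef m (k : R) (j : 'I_m) (l : 'I_m.+1) : R :=
  (l == lift ord0 j)%:R * k - (l == ord0)%:R.

Lemma sum_cone_coef m k j (y : m.+1.-tuple T) :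
  \sum_l cone_coef k j l * tnth y l ^+ 2 =
  k * tnth y (lift ord0 j) ^+ 2 - tnth y ord0 ^+ 2.
Proof.
rewrite big_ord_recl addrC; congr (_ + _); last first.
  by rewrite /cone_coef /= mul0r sub0r mulN1r.
rewrite (bigD1 j)//= /cone_coef eqxx mul1r subr0 big1 ?addr0// => i ij.
by rewrite (inj_eq lift_inj) (negPf ij) mul0r subr0 mul0r.
Qed.

Lemma isotropic_cone d (U : measurableType d) (P : probability U R) m
    (Z : U -> m.+1.-tuple T) (k : R) : isotropic P Z ->
  P [set u | forall j : 'I_m,
    k * tnth (Z u) (lift ord0 j) ^+ 2 <= tnth (Z u) ord0 ^+ 2] =
  gauss m.+1 [set y | forall j : 'I_m,
    k * tnth y (lift ord0 j) ^+ 2 <= tnth y ord0 ^+ 2].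
Proof.
move=> isoZ.
have qE : qcone (fun j : 'I_m => cone_coef k j) 0 = [set y : m.+1.-tuple T |
    forall j : 'I_m, k * tnth y (lift ord0 j) ^+ 2 <= tnth y ord0 ^+ 2].
  by apply/seteqP; split => y /= qy j; have := qy j;
    rewrite sum_cone_coef mul0r subr_le0.
have := isotropic_qcone_gauss (fun j : 'I_m => cone_coef k j) isoZ.
by rewrite qE.
Qed.

Lemma isotropic_cone_boundary d (U : measurableType d) (P : probability U R) m
    (Z : U -> m.+1.-tuple T) (k : R) (j : 'I_m) : isotropic P Z -> 0 < k ->
  P [set u | k * tnth (Z u) (lift ord0 j) ^+ 2 = tnth (Z u) ord0 ^+ 2] = 0%E.
Proof.
move=> isoZ k0; rewrite -(gauss_cone_boundary j k0).
(* both signs of the form, to describe its zero set as a cone *)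
pose a (b : bool) l := (-1) ^+ b * cone_coef k j l.
have qE : qcone a 0 = [set y : m.+1.-tuple T |
    k * tnth y (lift ord0 j) ^+ 2 = tnth y ord0 ^+ 2].
  have sa b y : \sum_l a b l * tnth y l ^+ 2 =
      (-1) ^+ b * (k * tnth y (lift ord0 j) ^+ 2 - tnth y ord0 ^+ 2).
    by rewrite -sum_cone_coef mulr_sumr; apply: eq_bigr => l _; rewrite -mulrA.
  apply/seteqP; split => y /= qy.
    apply/eqP; rewrite eq_le -subr_le0 -(subr_le0 _ (tnth y ord0 ^+ 2)).
    have := qy false; have := qy true; rewrite !sa mul0r expr0 expr1 mulN1r mul1r.
    by rewrite opprB => -> ->.
  by move=> b; rewrite sa qy subrr mulr0 mul0r.
by have := isotropic_qcone_gauss a isoZ; rewrite qE.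
Qed.

End section_cone.

Section section_cone_prob.
Context {R : realType} {n k p : nat} (le_kn : (k <= n)%N).
Variables (f : 'I_k -> 'I_n) (fc : 'I_p -> 'I_n) (eps : 'cV[R]_k).
Hypotheses (finj : injective f) (fcinj : injective fc)
  (ffc : forall a b, f a != fc b)
  (cover : forall i, (exists a, i = f a) \/ (exists b, i = fc b)).
Hypothesis eps2 : forall a, eps a 0 ^+ 2 = 1.
Hypothesis k_gt0 : (0 < k)%N.
Variables (mu : probability (orthogonal_group R n) R) (haar_mu : is_haar mu).

Let k0R : 0 < k%:R :> R. Proof. by rewrite ltr0n. Qed.

Lemma section_coord_fc g b : tnth (section_coord le_kn f fc eps g) (lift ord0 b) =
  section_vec le_kn f eps (orthogonal_mx g) (fc b) 0.
Proof. by rewrite tnthS tnth_mktuple. Qed.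

Lemma section_coord0 (g : orthogonal_group R n) :
  tnth (section_coord le_kn f fc eps g) ord0 ^+ 2 =
  k%:R * minor le_kn f (orthogonal_mx g) ^+ 2.
Proof. by rewrite tnth_tuple_cons0 /= exprMn sqr_sqrtr// ltW. Qed.

Lemma section_cone_prob :
  mu [set g | forall b, `|section_vec le_kn f eps (orthogonal_mx g) (fc b) 0| <=
    `|minor le_kn f (orthogonal_mx g)|] =
  ((Num.sqrt (2 * k%:R / pi))%:E * \int[@lebesgue_measure R]_(t in `[0%R, +oo[)
    ((expR (- (k%:R * t ^+ 2) / 2))%:E * gaussian (cube_tuple p t)))%E.
Proof.
have isoZ := isotropic_section_coord le_kn finj fcinj ffc cover eps2 k_gt0 haar_mu.
rewrite -gauss_cone// -(isotropic_cone k%:R isoZ); congr (mu _).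
by apply/seteqP; split => g /= gb b; have := gb b;
  rewrite section_coord0 section_coord_fc ler_pM2l//
    -(ler_sqr (normr_ge0 _) (normr_ge0 _)) !real_normK ?num_real.
Qed.

Lemma section_boundary_null b :
  mu [set g | `|section_vec le_kn f eps (orthogonal_mx g) (fc b) 0| =
    `|minor le_kn f (orthogonal_mx g)|] = 0%E.
Proof.
have isoZ := isotropic_section_coord le_kn finj fcinj ffc cover eps2 k_gt0 haar_mu.
rewrite -(isotropic_cone_boundary b isoZ k0R); congr (mu _).
apply/seteqP; split => g /=; rewrite section_coord0 section_coord_fc.
  by rewrite -(real_normK (num_real (section_vec _ _ _ _ _ _))) => ->;
    rewrite real_normK ?num_real.
move/(mulfI (lt0r_neq0 k0R))/eqP; rewrite eqf_sqr => /orP[] /eqP ->//.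
by rewrite normrN.
Qed.

End section_cone_prob.

(** * Vertices of a generic section of the cube *)

Section generic_section.
Import finmap.finmap.
Context {R : realType} {n k : nat}.
Implicit Types (X : {vspace 'cV[R]_n}) (x y z v : 'cV[R]_n) (S A : {set 'I_n}).

Definition sgn (P : {set 'I_n}) (i : 'I_n) : R := if i \in P then 1 else -1.

Lemma sgn_sqr P i : sgn P i * sgn P i = 1.
Proof. by rewrite /sgn; case: ifP; rewrite ?mulrNN mulr1. Qed.

Lemma norm_sgn P i : `|sgn P i| = 1.
Proof. by rewrite /sgn; case: ifP; rewrite ?normrN1 ?normr1. Qed.

Definition section X : set 'cV[R]_n := [set x | x \in X] `&` @cube R n.

(** The section projects bijectively onto the coordinates in S, and its points with
    coordinates 1 or -1 on S have no further coordinate equal to 1 or -1. *)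
Definition generic_at X S : Prop :=
  [/\ forall x, x \in X -> (forall i, i \in S -> x i 0 = 0) -> x = 0,
      forall z, exists2 x, x \in X & forall i, i \in S -> x i 0 = z i 0 &
      forall P x, x \in X -> (forall i, i \in S -> x i 0 = sgn P i) ->
        forall j, j \notin S -> `|x j 0| <> 1].

Definition generic X : Prop := forall S, #|S| = k -> generic_at X S.

Definition vertex_at X (S P : {set 'I_n}) x : Prop :=
  section X x /\ forall i, i \in S -> x i 0 = sgn P i.

Definition vertex_index X : {set {set 'I_n} * {set 'I_n}} :=
  finset (fun q : {set 'I_n} * {set 'I_n} =>
    [&& #|q.1| == k, q.2 \subset q.1 & `[< exists x, vertex_at X q.1 q.2 x >]]).

Lemma face0P (P F : set 'cV[R]_n) : is_face P F /\ affine_dim F 0 <->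
  exists2 x, F = [set x] & is_face P [set x].
Proof.
split=> [[Pf [x Fx [V [/eqP V0 yV _]]]]|[x -> Px]].
  have FE : F = [set x].
    apply/seteqP; split => y /=; last by move->.
    move=> /yV; move: V0; rewrite dimv_eq0 => /eqP ->; rewrite memv0 subr_eq0.
    by move/eqP.
  by exists x; rewrite -?FE.
split => //; exists x => //; exists 0%VS; split; first exact: dimv0.
- by move=> y ->; rewrite subrr mem0v.
- by move=> W _; exact: sub0v.
Qed.

Lemma vertex_at_uniq X S P x y : generic X -> #|S| = k ->
  vertex_at X S P x -> vertex_at X S P y -> x = y.
Proof.
move=> gX Sk [[/= xX _] xS] [[/= yX _] yS]; have [uniqS _ _] := gX S Sk.
apply/eqP; rewrite -subr_eq0; apply/eqP/uniqS; first exact: rpredB.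
by move=> i iS; rewrite !mxE xS// yS// subrr.
Qed.

(** The linear form that sums the signed coordinates in S is maximal on the cube exactly
    where these coordinates attain their bound. *)
Lemma vertex_at_face X S P x : generic X -> #|S| = k ->
  vertex_at X S P x -> is_face (section X) [set x].
Proof.
move=> gX Sk xv.
pose c : 'cV[R]_n := \col_i (if i \in S then sgn P i else 0).
have dotc y : dot c y = \sum_(i in S) sgn P i * y i 0.
  rewrite /dot [RHS]big_mkcond; apply: eq_bigr => i _; rewrite mxE.
  by case: ifP => // _; rewrite mul0r.
have le1 y i : cube y -> sgn P i * y i 0 <= 1.
  by move=> /(_ i) yi; rewrite (le_trans (ler_norm _))// normrM norm_sgn mul1r.
have sum1 : \sum_(i in S) 1 = k%:R :> R by rewrite sumr_const Sk.
exists c, k%:R; split.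
  by move=> y [_ cy]; rewrite dotc -sum1; apply: ler_sum => i _; exact: le1.
apply/seteqP; split => y /=.
  move=> ->; have [xX xS] := xv; split => //.
  rewrite dotc -sum1; apply: eq_bigr => i iS.
  by rewrite xS// sgn_sqr.
move=> [[yX cy] dy]; apply: (vertex_at_uniq gX Sk _ xv); split => // i iS.
have : \sum_(i in S) (1 - sgn P i * y i 0) == 0.
  by rewrite sumrB sum1 -dotc dy subrr.
rewrite psumr_eq0 => [/allP/(_ i)|j _]; last by rewrite subr_ge0 le1.
rewrite mem_index_enum iS /= subr_eq0 => /(_ isT) /eqP h.
by rewrite -[LHS]mul1r -(sgn_sqr P i) -mulrA -h mulr1.
Qed.

(** The bound t works because t |v i| / (1 - |x i|) <= 1 as soon as t (1 + M) <= 1,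
    where M adds up all these quotients. *)
Lemma room_in_cube x v A : cube x -> (forall i, i \in A -> v i 0 = 0) ->
  (forall i, i \notin A -> `|x i 0| < 1) ->
  exists2 t : R, 0 < t & forall s, `|s| <= t -> cube (x + s *: v).
Proof.
move=> cx vA xA.
pose M := \sum_(i | i \notin A) `|v i 0| / (1 - `|x i 0|).
have M0 : 0 <= M.
  by apply: sumr_ge0 => i iA; rewrite divr_ge0// subr_ge0 cx.
exists (1 + M)^-1; first by rewrite invr_gt0 ltr_pwDl.
move=> s st i; rewrite !mxE; have [iA|iA] := boolP (i \in A).
  by rewrite vA// mulr0 addr0; exact: cx.
apply: le_trans (ler_normD _ _) _; rewrite normrM -lerBrDl.
have x1 : 0 < 1 - `|x i 0| by rewrite subr_gt0 xA.
rewrite -[leRHS]mul1r -ler_pdivrMr// -mulrA.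
apply: (@le_trans _ _ ((1 + M)^-1 * (1 + M))); last by rewrite mulVf// gt_eqF// ltr_pwDl.
apply: ler_pM => //; first by rewrite divr_ge0// ltW.
rewrite /M (bigD1 i)//= addrCA lerDl addr_ge0//.
by apply: sumr_ge0 => j /andP[jA _]; rewrite divr_ge0// subr_ge0 cx.
Qed.

(** A vector v of the section vanishing on the active coordinates could be added to x in
    both directions without leaving the cube, so that the face would contain a
    segment. *)
Lemma face_active_inj X x v : is_face (section X) [set x] -> v \in X ->
  (forall i, `|x i 0| = 1 -> v i 0 = 0) -> v = 0.
Proof.
move=> [c [b [cb Fx]]] vX vA.
have : [set x] x by []. rewrite {1}Fx => -[[/= xX cx] dx].
have [i|i|t t0 ct] := @room_in_cube x v (finset (fun i => `|x i 0| == 1)) cx.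
  by rewrite inE => /eqP; exact: vA.
  by rewrite inE lt_neqAle cx andbT.
have Ps s : `|s| <= t -> section X (x + s *: v).
  move=> st; split; last exact: ct.
  by rewrite /= rpredD// rpredZ.
have dots s : dot c (x + s *: v) = b + s * dot c v.
  by rewrite -dx /dot mulr_sumr -big_split; apply: eq_bigr => i _; rewrite !mxE /=; ring.
have dv0 : dot c v = 0.
  have := cb _ (Ps t _); have := cb _ (Ps (- t) _).
  rewrite !dots normrN !ger0_norm ?(ltW t0)// => /(_ (lexx _)) h1 /(_ (lexx _)) h2.
  apply/eqP; rewrite -(mulrI_eq0 _ (lregP (lt0r_neq0 t0))) eq_le; apply/andP; split; lra.
have : [set x] (x + t *: v).
  rewrite Fx; split; first by apply: Ps; rewrite gtr0_norm.
  by rewrite /= dots dv0 mulr0 addr0.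
move=> /= /eqP; rewrite -subr_eq0 addrC addKr scaler_eq0 gt_eqF//= => /eqP.
exact.
Qed.

Lemma set_between A : (#|A| <= k)%N -> (k <= n)%N ->
  exists2 S : {set 'I_n}, A \subset S & #|S| = k.
Proof.
move=> Ak kn; have [m] := ubnP (k - #|A|); elim: m A Ak => // m IH A Ak Am.
have [Ak'|Ak'] := eqVneq #|A| k; first by exists A.
have Altk : (#|A| < k)%N by rewrite ltn_neqAle Ak'.
have [i iA] : exists i, i \notin A.
  apply/existsP; rewrite -negb_forall; apply/negP => /forallP Aall.
  have : (#|A| < n)%N by apply: leq_trans kn.
  rewrite -[n in (_ < n)%N]card_ord; rewrite ltnNge => /negP; apply.
  by apply: subset_leq_card; apply/fintype.subsetP => j _; exact: Aall.
have [||S AS Sk] := IH (i |: A)%SET.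
- by rewrite cardsU1 iA.
- by rewrite cardsU1 iA; lia.
exists S => //; apply: fintype.subset_trans AS; exact: finset.subsetUr.
Qed.

Lemma set_within A : (k <= #|A|)%N -> exists2 S : {set 'I_n}, S \subset A & #|S| = k.
Proof.
have [m] := ubnP (#|A| - k); elim: m A => // m IH A Am kA.
have [Ak|Ak] := eqVneq #|A| k; first by exists A.
have kltA : (k < #|A|)%N by rewrite ltn_neqAle eq_sym Ak.
have [i iA] : exists i, i \in A by apply/card_gt0P; apply: leq_trans kltA.
have [||S SA Sk] := IH (A :\ i)%SET.
- by have := cardsD1 i A; rewrite iA; lia.
- by have := cardsD1 i A; rewrite iA; lia.
exists S => //; apply: fintype.subset_trans SA _; exact: finset.subD1set.
Qed.

(** At a vertex the active coordinates determine the vectors of the section: there are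
    at least k of them, since otherwise some vector of the section would vanish on all
    of them and equal 1 at one more coordinate. *)
Lemma face_vertex_at X x : (k <= n)%N -> generic X -> is_face (section X) [set x] ->
  exists S (P : {set 'I_n}), [/\ #|S| = k, P \subset S & vertex_at X S P x].
Proof.
move=> kn gX fx; have [c [b [_ Fx]]] := fx.
have : [set x] x by []. rewrite {1}Fx => -[sx _].
have [xX cx] := sx.
pose A : {set 'I_n} := finset (fun i => `|x i 0| == 1).
have kA : (k <= #|A|)%N.
  rewrite leqNgt; apply/negP => Ak.
  have [S AS Sk] := set_between (ltnW Ak) kn.
  have [s sS sA] : exists2 s, s \in S & s \notin A.
    have /fintype.subsetPn[s] : ~~ (S \subset A).
      by apply/negP => /subset_leq_card; rewrite Sk leqNgt Ak.
    by exists s.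
  have [_ /(_ (delta_mx s 0))[v vX vS] _] := gX S Sk.
  have v0 : v = 0.
    apply: (face_active_inj fx vX) => i xi.
    have iA : i \in A by rewrite inE xi.
    rewrite vS; last exact: (fintype.subsetP AS).
    by rewrite mxE andbT; case: eqP => // si; move: sA; rewrite -si iA.
  by have := vS s sS; rewrite v0 !mxE !eqxx => /eqP; rewrite eq_sym oner_eq0.
have [S SA Sk] := set_within kA.
exists S, (finset (fun i => (i \in S) && (x i 0 == 1))); split => //.
  by apply/fintype.subsetP => i; rewrite inE => /andP[].
split => // i iS; rewrite /sgn inE iS /=; have [//|x1] := eqVneq (x i 0) 1.
have := fintype.subsetP SA i iS; rewrite inE => /eqP xi1.
by have [xi0|xi0] := ler0P (x i 0); move: xi1; [rewrite ler0_norm// => <-; rewrite opprK|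
  rewrite gtr0_norm// => /eqP; rewrite (negPf x1)].
Qed.

Lemma vertex_at_inj X x S (P : {set 'I_n}) S' (P' : {set 'I_n}) :
  generic X -> #|S| = k -> #|S'| = k ->
  P \subset S -> P' \subset S' -> vertex_at X S P x -> vertex_at X S' P' x ->
  S = S' /\ P = P'.
Proof.
move=> gX Sk S'k PS P'S'.
have actS S0 P0 : #|S0| = k -> vertex_at X S0 P0 x -> S0 = finset (fun i => `|x i 0| == 1).
  move=> S0k [[xX _] xS0]; apply/setP => i; rewrite inE.
  have [iS|iS] := boolP (i \in S0); first by rewrite xS0// norm_sgn eqxx.
  by have [_ _ /(_ P0 x xX xS0 i iS) /eqP/negPf ->] := gX S0 S0k.
move=> v v'; have SS' : S = S' by rewrite (actS _ _ Sk v) (actS _ _ S'k v').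
split => //; subst S'.
have actP (P0 : {set 'I_n}) : P0 \subset S -> vertex_at X S P0 x ->
    P0 = finset (fun i => (i \in S) && (x i 0 == 1)).
  move=> P0S [_ xS]; apply/setP => i; rewrite inE.
  have [iS|iS] := boolP (i \in S) => /=.
    rewrite xS// /sgn; case: ifP; rewrite ?eqxx// => _.
    by rewrite lt_eqF// (lt_trans (ltrN10 _)) ltr01.
  by apply/negbTE; apply: contra iS; exact: (fintype.subsetP P0S).
by rewrite (actP _ PS v) (actP _ P'S' v').
Qed.

(** The vertices of a generic section are in bijection with the pairs (S, P) for which
    the point of the section with coordinates 1 on P and -1 on the rest of S is in the
    cube: S is recovered as the set of active coordinates. *)
Lemma num_vertices_generic X : (k <= n)%N -> generic X ->
  num_faces 0 (section X) = (#|vertex_index X|%:R)%:E.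
Proof.
move=> kn gX.
pose pt (q : {set 'I_n} * {set 'I_n}) : 'cV[R]_n := xget 0 (vertex_at X q.1 q.2).
have ptP q : q \in vertex_index X ->
    [/\ #|q.1| = k, q.2 \subset q.1 & vertex_at X q.1 q.2 (pt q)].
  rewrite inE => /and3P[/eqP qk qs /asboolP [x vx]]; split => //.
  by rewrite /pt; case: xgetP => [y -> //|/(_ x)].
have -> : num_faces 0 (section X) =
    counting ((fun q => [set pt q]) @` [set` vertex_index X]).
  rewrite /num_faces; congr (counting _); apply/seteqP; split => F /=.
    move=> /face0P[x -> fx].
    have [S [P [Sk PS vx]]] := face_vertex_at kn gX fx.
    have qV : (S, P) \in vertex_index X by rewrite inE /= Sk eqxx PS; apply/asboolP; exists x.
    exists (S, P) => //; congr [set _]; apply: (vertex_at_uniq gX Sk _ vx).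
    by have [_ _] := ptP _ qV.
  move=> [q qV <-]; have [qk _ vq] := ptP q qV.
  apply/face0P; exists (pt q) => //; exact: vertex_at_face vq.
set phi := fun q => [set pt q].
have phi_inj : {in enum (vertex_index X) &, injective phi}.
  move=> [S P] [S' P']; rewrite !mem_enum => qV q'V phiE.
  have [/= Sk PS vq] := ptP _ qV; have [/= S'k P'S' vq'] := ptP _ q'V.
  have ptE : pt (S, P) = pt (S', P').
    by have : phi (S, P) (pt (S, P)) by []; rewrite phiE.
  rewrite -ptE in vq'.
  by have [-> ->] := vertex_at_inj gX Sk S'k PS P'S' vq vq'.
have finV : finite_set (phi @` [set` vertex_index X]).
  by apply: finite_image; exact: finite_finset.
rewrite /counting asboolT//; congr (_%:R%:E).
rewrite (_ : fset_set _ = [fset F in map phi (enum (vertex_index X))]%fset).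
  by rewrite card_fseq undup_id ?size_map ?cardE// map_inj_in_uniq ?enum_uniq.
apply/fsetP => F; rewrite in_fset_set// inE.
apply/idP/idP.
  by move=> /set_mem [q qV <-]; apply: map_f; rewrite mem_enum.
by move=> /mapP[q]; rewrite mem_enum => qV ->; apply/mem_set; exists q.
Qed.

End generic_section.

(** * Integrals of nonmeasurable functions *)

Section nonmeasurable_integral.
Context {R : realType} d (T : measurableType d) (mu : {measure set T -> \bar R}).
Local Open Scope ereal_scope.
Import HBNNSimple.

Lemma ge0_le_integral_sup (f g : T -> \bar R) : (forall x, 0 <= f x) ->
  (forall x, f x <= g x) -> \int[mu]_x f x <= \int[mu]_x g x.
Proof.
move=> f0 fg; rewrite !ge0_integralTE//; last first.
  by move=> x; apply: le_trans (fg x); exact: f0.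
apply: ereal_sup_le => _ [h /= hf <-]; exists h => //= x.
exact: le_trans (hf x) (fg x).
Qed.

(** The function f may fail to be measurable: its integral, a supremum over simple
    functions, is still insensitive to what happens on a null set. This is used for the
    number of vertices, which is only described on generic sections. *)
Lemma ge0_integral_full_eq (f g : T -> \bar R) (N : set T) : measurable N ->
  mu (~` N) = 0 -> (forall x, 0 <= f x) -> (forall x, 0 <= g x) ->
  measurable_fun setT g -> (forall x, N x -> f x = g x) ->
  \int[mu]_x f x = \int[mu]_x g x.
Proof.
move=> mN N0 f0 g0 mg fg.
have restr (h : T -> \bar R) : measurable_fun setT h -> (forall x, 0 <= h x) ->
    \int[mu]_x h x = \int[mu]_x (h \_ N) x.
  move=> mh h0; rewrite -integral_mkcond.
  rewrite (@ge0_negligible_integral _ _ _ mu setT (~` N))//; last exact: measurableC.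
  by rewrite setTD setCK.
apply/eqP; rewrite eq_le; apply/andP; split.
  rewrite [leLHS]ge0_integralTE//; apply/ge_ereal_sup => _ [h /= hf <-].
  rewrite -integralT_nnsfun (restr (EFin \o h)); last 2 first.
  - exact/measurable_EFinP.
  - by move=> x; rewrite /= lee_fin.
  apply: ge0_le_integral_sup => x; rewrite patchE; case: ifPn => //.
    by rewrite /= lee_fin.
  by move=> /set_mem Nx; rewrite -fg//; exact: hf.
rewrite restr//; apply: ge0_le_integral_sup => x; rewrite patchE; case: ifPn => //.
by move=> /set_mem Nx; rewrite fg.
Qed.

End nonmeasurable_integral.

(** * Sections by rotated coordinate subspaces *)

Lemma index_set_enum n k (S : {set 'I_n}) : #|S| = k ->
  exists (f : 'I_k -> 'I_n) (fc : 'I_(n - k) -> 'I_n),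
  [/\ injective f /\ injective fc, forall a, f a \in S, forall b, fc b \notin S,
      forall i, i \in S -> exists a, i = f a &
      forall i, i \notin S -> exists b, i = fc b].
Proof.
move=> Sk; have Sck : #|~: S|%SET = (n - k)%N by rewrite cardsCs finset.setCK card_ord Sk.
exists (fun a => enum_val (cast_ord (esym Sk) a)).
exists (fun b => enum_val (cast_ord (esym Sck) b)); split.
- by split=> i j /enum_val_inj /cast_ord_inj.
- by move=> a; exact: enum_valP.
- by move=> b; have := enum_valP (cast_ord (esym Sck) b); rewrite inE.
- move=> i iS; exists (cast_ord Sk (enum_rank_in iS i)).
  by rewrite cast_ordK enum_rankK_in.
- move=> i iS; have iSc : i \in (~: S)%SET by rewrite inE.
  exists (cast_ord Sck (enum_rank_in iSc i)).
  by rewrite cast_ordK enum_rankK_in.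
Qed.

Section rotated_subspace.
Context {R : realType} {n k : nat} (le_kn : (k <= n)%N).
Local Notation cols := (widen_ord le_kn).
Implicit Types (g : orthogonal_group R n) (S P : {set 'I_n}).

Lemma mem_rotated_subspace g (x : 'cV[R]_n) :
  x \in rotated_subspace le_kn g <->
  exists z, x = colsub cols (orthogonal_mx g) *m z.
Proof.
have delta_sum (z : 'cV[R]_k) :
    orthogonal_mx g *m (\sum_i z i 0 *: delta_mx (cols i) 0) =
    colsub cols (orthogonal_mx g) *m z.
  apply/matrixP => i j; rewrite ord1 mulmx_sumr summxE [RHS]mxE.
  apply: eq_bigr => l _; rewrite -scalemxAr mxE mulrC [in RHS]mxE; congr (_ * _).
  by rewrite -colE mxE.
split=> [/memv_imgP[u uV ->]|[z ->]].
  rewrite lfunE /=.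
  have -> := coord_span uV.
  exists (\col_i coord (coord_vectors R le_kn) i u); rewrite -delta_sum.
  congr (_ *m _); apply: eq_bigr => i _.
  by rewrite mxE -tnth_nth tnth_mktuple.
apply/memv_imgP; exists (\sum_i z i 0 *: delta_mx (cols i) 0); last first.
  by rewrite lfunE /= delta_sum.
apply: rpred_sum => i _; apply: rpredZ; apply: memv_span.
by apply/tnthP; exists i; rewrite tnth_mktuple.
Qed.

Lemma colsub_orthogonal_inj g (z : 'cV[R]_k) :
  colsub cols (orthogonal_mx g) *m z = 0 -> z = 0.
Proof.
move=> gz; suff : (colsub cols (orthogonal_mx g))^T *m colsub cols (orthogonal_mx g) = 1%:M.
  by move=> E; rewrite -[z]mul1mx -E -mulmxA gz mulmx0.
have /mulmx1C gg := orthogonal_mxP g.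
apply/matrixP => i j; move/matrixP/(_ (cols i) (cols j)): gg.
rewrite !mxE => gg; rewrite -[RHS]gg.
by apply: eq_bigr => l _; rewrite !mxE.
Qed.

Section at_index_set.
Context {p : nat} (S : {set 'I_n}) (f : 'I_k -> 'I_n) (fc : 'I_p -> 'I_n).
Hypotheses (fS : forall a, f a \in S) (fcS : forall b, fc b \notin S)
  (Sf : forall i, i \in S -> exists a, i = f a)
  (Sfc : forall i, i \notin S -> exists b, i = fc b).
Variable g : orthogonal_group R n.
Local Notation X := (rotated_subspace le_kn g).
Local Notation D := (minor le_kn f (orthogonal_mx g)).
Local Notation U eps := (section_vec le_kn f eps (orthogonal_mx g)).

Definition sgn_col P : 'cV[R]_k := \col_a sgn P (f a).

Lemma rows_colsub z a :
  (colsub cols (orthogonal_mx g) *m z) (f a) (0 : 'I_1) =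
  (mxsub f cols (orthogonal_mx g) *m z) a 0 :> R.
Proof. by rewrite !mxE; apply: eq_bigr => i _; rewrite !mxE. Qed.

Lemma section_vec_mem eps : U eps \in X.
Proof. by apply/mem_rotated_subspace; eexists. Qed.

(** A vector in the kernel of the submatrix gives a nonzero vector of the section that
    vanishes on S. *)
Lemma section_inj_minor :
  (forall x, x \in X -> (forall i, i \in S -> x i 0 = 0) -> x = 0) <-> D != 0.
Proof.
split=> [uniqS|D0 x /mem_rotated_subspace[z ->] xS].
  apply/negP => /eqP D0.
  have : \det (mxsub f cols (orthogonal_mx g))^T == 0 by rewrite det_tr; apply/eqP.
  case/det0P => v v0 vM; case/negP: v0; apply/eqP/trmx_inj; rewrite trmx0.
  apply: (@colsub_orthogonal_inj g); apply: uniqS.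
    by apply/mem_rotated_subspace; exists v^T.
  move=> i /Sf[a ->]; rewrite rows_colsub.
  by rewrite -[mxsub _ _ _]trmxK -trmx_mul vM trmx0 mxE.
suff -> : z = 0 by rewrite mulmx0.
have Mz : mxsub f cols (orthogonal_mx g) *m z = 0.
  by apply/matrixP => a j; rewrite ord1 -rows_colsub xS// mxE.
have uM : mxsub f cols (orthogonal_mx g) \in unitmx by rewrite unitmxE unitfE.
by rewrite -[z](mulKmx uM) Mz mulmx0.
Qed.

Lemma section_surj_minor : D != 0 ->
  forall z : 'cV[R]_n, exists2 x, x \in X & forall i, i \in S -> x i 0 = z i 0.
Proof.
move=> D0 z.
have uM : mxsub f cols (orthogonal_mx g) \in unitmx by rewrite unitmxE unitfE.
exists (colsub cols (orthogonal_mx g) *m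
    (invmx (mxsub f cols (orthogonal_mx g)) *m rowsub f z)).
  by apply/mem_rotated_subspace; eexists.
by move=> i /Sf[a ->]; rewrite rows_colsub mulKVmx// mxE.
Qed.

Lemma section_vecE (x : 'cV[R]_n) (eps : 'cV[R]_k) : D != 0 -> x \in X ->
  (forall a, x (f a) 0 = eps a 0) <-> D *: x = U eps.
Proof.
move=> D0 xX; split=> [xf|DxU a]; last first.
  apply: (mulfI D0); rewrite -(section_vec_f le_kn f eps) -DxU.
  by rewrite [RHS]mxE.
have [z xz] := (mem_rotated_subspace g x).1 xX.
have <- : mxsub f cols (orthogonal_mx g) *m z = eps.
  by apply/matrixP => a j; rewrite ord1 -rows_colsub -xz xf.
by rewrite /section_vec [\adj _ *m _]mulmxA mul_adj_mx mul_scalar_mx -scalemxAr -xz.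
Qed.

Lemma sgn_colE x P : (forall i, i \in S -> x i 0 = sgn P i) <->
  (forall a, x (f a) (0 : 'I_1) = sgn_col P a 0 :> R).
Proof.
split=> [xS a|xf i /Sf[a ->]]; first by rewrite xS// mxE.
by rewrite xf mxE.
Qed.

Lemma vertex_at_rotated P : D != 0 -> (exists x, vertex_at X S P x) <->
  forall b, `|U (sgn_col P) (fc b) 0| <= `|D|.
Proof.
move=> D0; split=> [[x [[xX cx] xS]] b|Ule].
  have /(section_vecE _ D0 xX) <- := (sgn_colE x P).1 xS.
  by rewrite mxE normrM ger_pMr ?normr_gt0.
pose x := D^-1 *: U (sgn_col P).
have xX : x \in X by apply: rpredZ; exact: section_vec_mem.
have xS : forall i, i \in S -> x i 0 = sgn P i.
  by apply/sgn_colE/(section_vecE _ D0 xX); rewrite scalerA mulfV// scale1r.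
exists x; split => //; split => // i.
have [iS|/Sfc[b ->]] := boolP (i \in S); first by rewrite xS// norm_sgn.
by rewrite mxE normrM normfV mulrC ler_pdivrMr ?normr_gt0// mul1r.
Qed.

Lemma generic_at_rotated : generic_at X S <->
  D != 0 /\ forall P b, `|U (sgn_col P) (fc b) 0| <> `|D|.
Proof.
split=> [[/section_inj_minor D0 _ nb]|[D0 nb]].
  split=> // P b UD.
  pose x := D^-1 *: U (sgn_col P).
  have xX : x \in X by apply: rpredZ; exact: section_vec_mem.
  have xS : forall i, i \in S -> x i 0 = sgn P i.
    by apply/sgn_colE/(section_vecE _ D0 xX); rewrite scalerA mulfV// scale1r.
  apply: (nb P x xX xS (fc b)) => //.
  by rewrite mxE normrM normfV UD mulVf// normr_eq0.
split; [exact/section_inj_minor|exact: section_surj_minor|].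
move=> P x xX xS j /Sfc[b ->] x1; apply: (nb P b).
have /(section_vecE _ D0 xX) <- := (sgn_colE x P).1 xS.
by rewrite mxE normrM x1 mulr1.
Qed.

End at_index_set.

End rotated_subspace.

Section expected_vertices.
Context {R : realType} {n k : nat} (k_gt0 : (0 < k)%N) (lt_kn : (k < n)%N).
Variables (mu : probability (orthogonal_group R n) R) (haar_mu : is_haar mu).
Local Notation T := (measurableTypeR R).
Local Notation le_kn := (ltnW lt_kn).
Local Notation rot := (@rotated_subspace R n k le_kn).
Local Open Scope ereal_scope.

Definition cone_prob : \bar R :=
  (Num.sqrt (2 * k%:R / pi))%:E * \int[@lebesgue_measure R]_(t in `[0%R, +oo[)
    ((expR (- (k%:R * t ^+ 2) / 2))%:E * gaussian (cube_tuple (n - k) t)).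

Lemma measurable_null_compl d (U : measurableType d) (P : probability U R) (A : set U) :
  measurable A -> P A = 0 -> P (~` A) = 1.
Proof. by move=> mA A0; rewrite probability_setC// [X in _ - X]A0 sube0. Qed.

Lemma generic_at_ae (S : {set 'I_n}) : #|S| = k ->
  measurable [set g | generic_at (rot g) S] /\
  mu [set g | generic_at (rot g) S] = 1.
Proof.
move=> Sk; have [f [fc [[finj fcinj] fS fcS Sf Sfc]]] := index_set_enum Sk.
have ffc a b : f a != fc b by apply: contraNneq (fcS b) => <-.
have cover i : (exists a, i = f a) \/ (exists b, i = fc b).
  by have [/Sf|/Sfc] := boolP (i \in S); [left|right].
have eps2 P a : (@sgn_col R n k f P a 0 ^+ 2 = 1)%R by rewrite mxE expr2 sgn_sqr.
pose bad (q : option ({set 'I_n} * 'I_(n - k))) : set (orthogonal_group R n) :=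
  if q is Some (P, b) then [set g |
    `|section_vec le_kn f (sgn_col f P) (orthogonal_mx g) (fc b) 0| =
    `|minor le_kn f (orthogonal_mx g)|]%R
  else [set g | minor le_kn f (orthogonal_mx g) = 0%R].
have mbad q : measurable (bad q).
  case: q => [[P b]|]; last first.
    exact: (measurable_preimage (measurable_minor _ _) (measurable_set1 0%R)).
  rewrite /bad; set s := section_vec _ _ _.
  have md : measurable_fun setT (fun g : orthogonal_group R n =>
      `|s (orthogonal_mx g) (fc b) 0| - `|minor le_kn f (orthogonal_mx g)| : T)%R.
    apply: measurable_funB; apply: measurableT_comp => //.
      exact: measurable_section_vec.
    exact: measurable_minor.
  have := measurable_preimage md (measurable_set1 0%R); congr (measurable _).
  apply/seteqP; split => g /=; last by move=> ->; rewrite subrr.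
  by move/eqP; rewrite subr_eq0 => /eqP.
have bad0 q : mu (bad q) = 0.
  case: q => [[P b]|]; last exact: minor_null.
  exact: (section_boundary_null le_kn finj fcinj ffc cover (eps2 P) k_gt0 haar_mu).
have gE : [set g | generic_at (rot g) S] = ~` [set g | exists q, bad q g].
  apply/seteqP; split => g /=.
    move=> /(generic_at_rotated _ fS fcS Sf Sfc)[/eqP D0 nb] [[[P b]|] //].
    exact: nb.
  move=> nbad; apply/(generic_at_rotated _ fS fcS Sf Sfc); split.
    by apply/eqP => D0; apply: nbad; exists None.
  by move=> P b UD; apply: nbad; exists (Some (P, b)).
rewrite gE; split; first by apply/measurableC/measurable_exists.
apply: measurable_null_compl; first exact: measurable_exists.
exact: exists_null.
Qed.

Lemma generic_ae : measurable [set g | @generic R n k (rot g)] /\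
  mu [set g | @generic R n k (rot g)] = 1.
Proof.
pose bad (S : {set 'I_n}) : set (orthogonal_group R n) :=
  if #|S| == k then ~` [set g | generic_at (rot g) S] else set0.
have mbad S : measurable (bad S).
  by rewrite /bad; case: eqP => // /generic_at_ae[mS _]; exact: measurableC.
have bad0 S : mu (bad S) = 0.
  rewrite /bad; case: eqP => [/generic_at_ae[mS S1]|]; last by rewrite measure0.
  by rewrite probability_setC// [X in _ - X]S1 subee.
have -> : [set g | @generic R n k (rot g)] = ~` [set g | exists S, bad S g].
  apply/seteqP; split => g /=.
    by move=> gg [S]; rewrite /bad; case: eqP => // Sk; apply; exact: gg.
  move=> nbad S Sk; apply: contrapT => ngS; apply: nbad; exists S.
  by rewrite /bad Sk eqxx.
split; first by apply/measurableC/measurable_exists.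
apply: measurable_null_compl; first exact: measurable_exists.
exact: exists_null.
Qed.

Definition vertex_set (q : {set 'I_n} * {set 'I_n}) : set (orthogonal_group R n) :=
  [set g | @generic R n k (rot g) /\ exists x, vertex_at (rot g) q.1 q.2 x].

(** Up to a null set the event is the cone event for the section coordinates. *)
Lemma vertex_set_prob (q : {set 'I_n} * {set 'I_n}) : #|q.1| = k ->
  measurable (vertex_set q) /\ mu (vertex_set q) = cone_prob.
Proof.
case: q => S P /= Sk; have [mg g1] := generic_ae.
have [f [fc [[finj fcinj] fS fcS Sf Sfc]]] := index_set_enum Sk.
have ffc a b : f a != fc b by apply: contraNneq (fcS b) => <-.
have cover i : (exists a, i = f a) \/ (exists b, i = fc b).
  by have [/Sf|/Sfc] := boolP (i \in S); [left|right].
have eps2 a : (@sgn_col R n k f P a 0 ^+ 2 = 1)%R by rewrite mxE expr2 sgn_sqr.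
pose C := [set g : orthogonal_group R n | forall b,
  `|section_vec le_kn f (sgn_col f P) (orthogonal_mx g) (fc b) 0| <=
    `|minor le_kn f (orthogonal_mx g)|]%R.
have mC : measurable C.
  apply: measurable_forall => b; apply: measurable_bool_set.
  apply: measurable_fun_ler; apply: measurableT_comp => //.
    exact: measurable_section_vec.
  exact: measurable_minor.
have -> : vertex_set (S, P) = C `&` [set g | @generic R n k (rot g)].
  apply/seteqP; split => g /=.
    move=> [gg ex]; split => //; have := gg S Sk.
    move=> /(generic_at_rotated _ fS fcS Sf Sfc)[D0 _].
    exact/(vertex_at_rotated fS Sf Sfc P D0).
  move=> [Cg gg]; split => //; have := gg S Sk.
  move=> /(generic_at_rotated _ fS fcS Sf Sfc)[D0 _].
  exact/(vertex_at_rotated fS Sf Sfc P D0).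
split; first exact: measurableI.
rewrite probability_setI1//.
exact: (section_cone_prob le_kn finj fcinj ffc cover eps2 k_gt0 haar_mu).
Qed.

Lemma card_vertex_indices :
  #|finset (fun q : {set 'I_n} * {set 'I_n} => (#|q.1| == k) && (q.2 \subset q.1))| =
  (2 ^ k * 'C(n, k))%N.
Proof.
rewrite -sum1_card.
rewrite (eq_bigl (fun q : {set 'I_n} * {set 'I_n} => (#|q.1| == k) && (q.2 \subset q.1)));
  last by move=> q; rewrite inE.
rewrite -(pair_big_dep (fun S : {set 'I_n} => #|S| == k)
  (fun S P : {set 'I_n} => P \subset S) (fun _ _ => 1%N)) /=.
rewrite (eq_bigr (fun=> (2 ^ k)%N)) => [|S /eqP Sk]; last first.
  rewrite -Sk -card_powerset -sum1_card; apply: eq_bigl => P.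
  by rewrite powersetE.
rewrite sum_nat_const mulnC; congr (_ * _)%N.
by rewrite -[n in RHS]card_ord -card_draws cardsE.
Qed.

End expected_vertices.

Theorem proposition2p2 (R : realType) (n k : nat) (k_ge1 : (1 <= k)%N)
    (lt_kn : (k < n)%N) (mu : probability (orthogonal_group R n) R)
    (haar_mu : is_haar mu) :
  (expected_faces (ltnW lt_kn) mu 0 =
   (2 ^+ k * 'C(n, k)%:R * Num.sqrt (2 * k%:R / pi))%:E *
   \int[@lebesgue_measure R]_(t in `[0%R, +oo[)
     ((expR (- (k%:R * t ^+ 2) / 2))%:E * gaussian (cube_tuple (n - k) t)))%E.
Proof.
(* the number of vertices is replaced by a finite sum of indicators, which agrees with
   it on generic sections and is measurable *)
Local Open Scope ereal_scope.
have [mg g1] := generic_ae k_ge1 lt_kn haar_mu.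
pose Gr := grassmannian R (ltnW lt_kn).
pose V (X : Gr) : {vspace 'cV[R]_n} := set_val X.
pose idx := finset (fun q : {set 'I_n} * {set 'I_n} => (#|q.1| == k) && (q.2 \subset q.1)).
pose W (q : {set 'I_n} * {set 'I_n}) : set Gr := if q \in idx then
  [set X | @generic R n k (V X) /\ exists x, vertex_at (V X) q.1 q.2 x] else set0.
have mW q : measurable (W q).
  rewrite /W inE; case: ifPn => // /andP[/eqP qk _].
  have [mq _] := vertex_set_prob k_ge1 lt_kn haar_mu qk.
  by rewrite /measurable /= /grassmannian_measurable /image_set_system /= setTI.
have muW q : q \in idx -> grassmannian_measure (ltnW lt_kn) mu (W q) = @cone_prob R n k.
  move=> qi; rewrite /W qi; move: qi; rewrite inE => /andP[/eqP qk _].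
  by have [_] := vertex_set_prob k_ge1 lt_kn haar_mu qk.
pose N : set Gr := [set X | @generic R n k (V X)].
have mN : measurable N.
  by rewrite /measurable /= /grassmannian_measurable /image_set_system /= setTI.
pose h (X : Gr) : \bar R := \sum_(q <- enum idx) (\1_(W q) X)%:E.
have mh q : measurable_fun setT (fun X => (\1_(W q) X)%:E : \bar R).
  by apply/measurable_EFinP; apply: measurable_indic; exact: mW.
transitivity (\int[grassmannian_measure (ltnW lt_kn) mu]_X h X).
  apply: (@ge0_integral_full_eq _ _ _ _ _ _ N mN).
  - transitivity (grassmannian_measure (ltnW lt_kn) mu (~` N)); first by [].
    by rewrite probability_setC// [X in _ - X](_ : _ = 1) ?subee//; exact: g1.
  - by move=> X; rewrite /num_faces /counting; case: ifPn; rewrite ?lee_fin ?leey.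
  - by move=> X; apply: sume_ge0 => q _; rewrite lee_fin.
  - exact: emeasurable_sum.
  - move=> X gX; rewrite -/(section (V X)) (num_vertices_generic (ltnW lt_kn) gX).
    rewrite /h big_enum /=.
    rewrite (eq_bigr (fun q => ((q \in @vertex_index R n k (V X))%:R)%:E)); last first.
      move=> q qi; rewrite /W qi; move: qi; rewrite inE => /andP[qk qs].
      rewrite indicE !inE qk qs /=.
      congr ((nat_of_bool _)%:R%:E); apply/idP/asboolP; first by move=> /set_mem[].
      by move=> ex; apply/mem_set.
    rewrite sumEFin -natr_sum; congr (_%:R%:E).
    rewrite -sum1_card big_mkcond [RHS]big_mkcond; apply: eq_bigr => q _ /=.
    by rewrite !inE; case: (_ == _) => //=; case: (_ \subset _) => //=; case: asboolP.
rewrite ge0_integral_sum//.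
have cfin : @cone_prob R n k \is a fin_num.
  have [q qi|noq] := pickP (mem idx).
    by rewrite -(muW q qi) fin_num_measure.
  have : #|idx| = 0%N by apply: eq_card0.
  rewrite card_vertex_indices => /eqP; rewrite muln_eq0 expn_eq0/= => /eqP.
  by move/eqP; rewrite -leqn0 leqNgt bin_gt0 (ltnW lt_kn).
rewrite big_enum /= (eq_bigr (fun=> (fine (@cone_prob R n k))%:E)) => [|q qi]; last first.
  by rewrite integral_indic// setIT fineK//; exact: muW.
rewrite sumEFin sumr_const card_vertex_indices.
transitivity ((2 ^ k * 'C(n, k))%:R%:E * @cone_prob R n k).
  by rewrite -[in RHS](fineK cfin) -EFinM mulr_natl.
by rewrite /cone_prob muleA -EFinM natrM natrX.
Qed.
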